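(* Let $k\ge 1$ be an integer, let $m=2^p+q$, where $p\ge 0$ and $0\le q<2^p$ are integers, and let $d=2^{k+p-1}+q$. If $\mathcal{F}$ is a finite family of polytopes in $\mathbb{R}^d$ such that $\chi(\mathrm{KG}^{2^k}(\mathcal{F})) \le m$, then there exist $k$ affine hyperplanes in $\mathbb{R}^d$ which pierce $\mathcal{F}$.
   Context: A polytope in $\mathbb{R}^d$ is the convex hull of a finite non-empty set of points of $\mathbb{R}^d$. For a finite family $\mathcal{F}$ of non-empty sets and an integer $r\ge 2$, the $r$-uniform Kneser hypergraph $\mathrm{KG}^r(\mathcal{F})$ has vertex set $\mathcal{F}$ and a hyperedge $\{A_1,\dots,A_r\}$ for every collection of pairwise disjoint $A_1,\dots,A_r\in\mathcal{F}$. Its chromatic number $\chi(\mathrm{KG}^r(\mathcal{F}))$ is the smallest number of colors needed to color the vertices so that no hyperedge is monochromatic; thus $\chi(\mathrm{KG}^r(\mathcal{F}))\le m$ means there is a partition $\mathcal{F}=\mathcal{F}_1\cup\dots\cup\mathcal{F}_m$ such that no $r$ sets from any one $\mathcal{F}_i$ are pairwise disjoint. A collection of $k$ (not necessarily distinct) hyperplanes pierces a family $\mathcal{F}$ of non-empty subsets of $\mathbb{R}^d$ if the union of these hyperplanes intersects each set from $\mathcal{F}$. *)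

(* Defs.v *)
From HB Require Import structures.
From mathcomp Require Import all_boot all_order all_algebra.
From mathcomp Require Import all_classical all_reals.
From mathcomp Require Export convex.

Set Implicit Arguments.
Unset Strict Implicit.
Unset Printing Implicit Defensive.

Import Order.TTheory GRing.Theory Num.Theory.

Local Open Scope classical_set_scope.

Record hypergraph (V : Type) := Hypergraph {
  vertices : set V;
  hyperedges : set (set V) }.

Section Coloring.
Context {V : Type}.
Implicit Type H : hypergraph V.

(* Values of c outside the vertex set are irrelevant. *)
Definition proper_coloring H (n : nat) (c : V -> nat) : Prop :=
  (forall v, vertices H v -> (c v < n)%N) /\
  (forall e, hyperedges H e -> ~ exists i, forall v, e v -> c v = i).

Definition colorable H (n : nat) : Prop := exists c, proper_coloring H n c.

(* The junk value 0 is taken only if no finite number of colors suffices; see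
   kneser_colorable. *)
Definition chromatic_number H : nat :=
  xget 0%N [set n | colorable H n /\
                    forall n', colorable H n' -> (n <= n')%N].

Lemma colorable_leq H m n : (m <= n)%N -> colorable H m -> colorable H n.
Proof.
move=> mn [c [cm ce]]; exists c; split => // v vH.
exact: leq_trans (cm v vH) mn.
Qed.

Lemma chromatic_number_leP H n m : colorable H n ->
  (chromatic_number H <= m)%N <-> colorable H m.
Proof.
move=> Hn; rewrite /chromatic_number.
case: xgetP => [x _ [Hx x_min]|none].
  by split=> [/colorable_leq|]; [apply|exact: x_min].
have ex : exists n, `[< colorable H n >] by exists n; apply/asboolP.
case: (ex_minnP ex) => x /asboolP Hx x_min; exfalso.
apply: (none x); split=> // n' /asboolP; exact: x_min.
Qed.

End Coloring.

(* For non-empty sets, pairwise disjoint implies pairwise distinct, so the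
   range of A below has exactly r elements. *)
Definition kneser_hypergraph (T : Type) (r : nat) (F : set (set T)) :
    hypergraph (set T) :=
  {| vertices := F;
     hyperedges := [set e | exists A : 'I_r -> set T,
       [/\ forall i, F (A i), trivIset setT A & e = range A]] |}.

Lemma kneser_colorable (T : Type) (r : nat) (F : set (set T)) :
  (2 <= r)%N -> finite_set F -> (forall A, F A -> A !=set0) ->
  exists n, colorable (kneser_hypergraph r F) n.
Proof.
move=> r2 [n /card_set_bijP[f [fI finj _]]] F0; exists n, f; split=> [v|e].
  exact: fI.
move=> [A [FA /trivIsetP A_disj ->]] [i ci].
pose i0 : 'I_r := Ordinal (ltnW r2); pose i1 : 'I_r := Ordinal r2.
have A01 : A i0 = A i1.
  by apply: finj; rewrite ?inE//= !ci//; eexists.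
have [x x0] := F0 _ (FA i0).
have /seteqP[/(_ x) + _] := A_disj i0 i1 Logic.I Logic.I isT.
by apply; split=> //; rewrite -A01.
Qed.

Section Geometry.
Local Open Scope ring_scope.
Context {R : realType}.

Definition convex_hull (M : lmodType R) (S : set M) : set M :=
  smallest (@convex_set R M) S.

Definition is_polytope (d : nat) (P : set 'rV[R]_d) : Prop :=
  exists S : set 'rV[R]_d, [/\ finite_set S, S !=set0 & P = convex_hull S].

Lemma polytope_neq0 (d : nat) (P : set 'rV[R]_d) : is_polytope P -> P !=set0.
Proof. by move=> [S [_ [x Sx] ->]]; exists x; exact: sub_gen_smallest. Qed.

Definition is_hyperplane (d : nat) (h : set 'rV[R]_d) : Prop :=
  exists (a : 'rV[R]_d) (b : R),
    a != 0 /\ h = [set x | \sum_(i < d) a 0 i * x 0 i = b].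

End Geometry.

Definition pierces (T : Type) (k : nat) (h : 'I_k -> set T)
    (F : set (set T)) : Prop :=
  forall A, F A -> (\bigcup_(i in setT) h i) `&` A !=set0.

(* Main.v *)
Require Import Defs.
From mathcomp Require Import all_boot all_order all_algebra.
From mathcomp Require Import all_classical all_reals.
From mathcomp Require Import interval_inference topology normedtype sequences.
From mathcomp Require Import zify ring lra.

(** Write k affine forms on R^d as a matrix x with k rows, none of them zero.
    The forms cut R^d into 2^k open orthants, indexed by sign vectors g. For
    each colour j let M_j(g) be the sum, over the polytopes of colour j, of the
    product of the positive parts of all the forms, with signs g, at all the
    vertices; it is positive exactly when the open orthant g contains a polytope
    of colour j. Suppose that for each j the number M_j(g) does not depend on g.
    If it is positive, then there are 2^k polytopes of colour j in different
    open orthants, which are pairwise disjoint, and the colouring is not proper.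
    So it is zero for each j, no polytope lies in an open orthant, and by
    convexity each of them meets the zero set of one of the forms.

    By Fourier inversion on the group of sign vectors, M_j is constant if the
    sum of the (-1)^(a.g) M_j(g) vanishes for all nonzero characters a
    ([constant_of_char_sums]). This sum is a continuous function of x, and
    changing the signs of the rows of x by h multiplies it by (-1)^(a.h). What
    is needed is thus a Borsuk-Ulam theorem for a product of k spheres of
    dimension d: functions f_1, ..., f_N with characters a_1, ..., a_N have a
    common zero if the coefficient of x_1^d ... x_k^d in the product of the
    linear forms <a_j, x> over F_2 is not zero ([equivariant_common_zero]).

    It is proved by counting modulo 2. Take the boundaries of cubes as spheres,
    subdivided by a grid. Given functions s_1, ..., s_N from cells to F_2, count
    the maximal ascending chains of cells, up to the group, in which s_i changes
    at the i-th step for all i. Since the product of spheres is a manifold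
    without boundary, a Stokes argument shows that the count depends only on the
    way in which the group changes the s_i ([rho_sweep_swap]). If s_i is made
    from the signs of the first nonzero coordinates in the blocks, the chains
    can be listed and their number is the coefficient above ([rho_sweep_chi]).
    If each top cell had a constant sign of some f_j, and s_j were this sign, no
    chain would count, since s_j cannot change within a cell where f_j has
    constant sign. So there is a cell on which no f_j has a constant sign
    ([signless_cell]), and refining the grid yields a common zero.

    For the characters at hand the product of linear forms is D^m, where D is
    the product of all nonzero linear forms in k variables. It suffices that D^m
    has a monomial with all exponents at most d ([dickson_expr_monomial]): the
    missing exponents are supplied by adding entries of x to the functions. Seen
    as a polynomial in the last variable, D is, up to the same product in one
    variable less, the product of the X + v over a vector space of forms v, in
    which only the exponents 2^j occur; this gives enough control on its powers
    for an induction on k. *)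

Set Implicit Arguments.
Unset Strict Implicit.
Unset Printing Implicit Defensive.

Import Order.TTheory GRing.Theory Num.Theory.
Import numFieldNormedType.Exports.

(** * Sums modulo 2 *)

Section Parity.
Local Open Scope ring_scope.

Lemma F2_addrr (x : 'F_2) : x + x = 0.
Proof. by rewrite addrr_pchar2 // pchar_Fp. Qed.

Lemma F2_natb_add (a b : bool) : (a (+) b)%:R = a%:R + b%:R :> 'F_2.
Proof. by case: a; case: b; rewrite ?addr0 ?add0r ?F2_addrr. Qed.

(** The terms at (p, q) and (q, p) cancel. Two counts of chains of cells
    below have this form: the two ways to move up twice, and the two top cells
    that share a facet. *)
Lemma sum_symmetric_offdiag (I : finType) (G : I -> I -> 'F_2) :
  (forall p q, G p q = G q p) -> (forall p, G p p = 0) ->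
  \sum_p \sum_q G p q = 0.
Proof.
move=> Gsym Gdiag; pose lt (p q : I) := (enum_rank p < enum_rank q)%N.
have split_row p : \sum_q G p q =
    \sum_(q | lt q p) G p q + \sum_(q | lt p q) G p q.
  rewrite (bigID (lt^~ p)) /=; congr (_ + _).
  rewrite [LHS](bigD1 p) ?/lt ?ltnn //= Gdiag add0r; apply: eq_bigl => q.
  rewrite -leqNgt ltn_neqAle andbC (inj_eq val_inj) (inj_eq enum_rank_inj).
  by rewrite eq_sym.
under eq_bigr do rewrite split_row.
rewrite big_split /= [X in _ + X](exchange_big_dep xpredT) //=.
under [X in _ + X]eq_bigr do under eq_bigr do rewrite Gsym.
by rewrite F2_addrr.
Qed.

End Parity.

(** * Iterated polynomial rings over F_2 *)

Section Tower.
Local Open Scope ring_scope.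

(** F_2[x_0, ..., x_(n-1)], with the last variable outermost, so that taking a
    coefficient in the last variable is taking an ordinary coefficient. *)
Fixpoint tower (n : nat) : comNzRingType :=
  if n is m.+1 then ({poly tower m} : comNzRingType) else ('F_2 : comNzRingType).

Fixpoint tvar (n : nat) : nat -> tower n :=
  if n is m.+1 return nat -> tower n
  then fun i => if i == m then 'X else (tvar m i)%:P else fun=> 0.

(** The coefficient at the monomial with exponents e 0, ..., e (n - 1). *)
Fixpoint mcoef (n : nat) : tower n -> (nat -> nat) -> 'F_2 :=
  if n is m.+1 return tower n -> (nat -> nat) -> 'F_2
  then fun p e => mcoef (p : {poly tower m})`_(e m) e else fun c _ => c.

Lemma mcoefD n (p q : tower n) e : mcoef (p + q) e = mcoef p e + mcoef q e.
Proof. by elim: n p q => //= n IH p q; rewrite coefD IH. Qed.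

Lemma mcoef0 n e : mcoef (0 : tower n) e = 0.
Proof. by elim: n => //= n IH; rewrite coef0 IH. Qed.

Lemma mcoef_sum n (I : Type) (r : seq I) (P : pred I) (F : I -> tower n) e :
  mcoef (\sum_(i <- r | P i) F i) e = \sum_(i <- r | P i) mcoef (F i) e.
Proof.
by apply: (big_morph (fun p => mcoef p e)) => [p q|]; rewrite (mcoefD, mcoef0).
Qed.

Lemma eq_mcoef n (p : tower n) e e' :
  (forall i, (i < n)%N -> e i = e' i) -> mcoef p e = mcoef p e'.
Proof.
elim: n p => //= n IH p ee'; rewrite ee' //; apply: IH => i lt.
by apply: ee'; rewrite ltnW.
Qed.

Lemma mcoef1 n e : mcoef (1 : tower n) e = [forall i : 'I_n, e i == 0%N]%:R.
Proof.
elim: n => [|n IH] /=.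
  by rewrite (_ : [forall i : 'I_0, _] = true) //; apply/forallP; case.
rewrite coef1; have [en|en] := eqVneq (e n) 0%N; last first.
  rewrite mulr0n mcoef0; case: forallP => // /(_ ord_max) /=.
  by rewrite (negPf en).
rewrite mulr1n IH; congr (nat_of_bool _)%:R.
apply/forallP/forallP => all0 i; last exact: (all0 (widen_ord (leqnSn n) i)).
have := ltn_ord i; rewrite ltnS leq_eqVlt => /orP[/eqP ->|lt]; first exact/eqP.
exact: (all0 (Ordinal lt)).
Qed.

Lemma mcoefM_var n (p : tower n) i e : (i < n)%N ->
  mcoef (p * tvar n i) e =
  if e i is _.+1 then mcoef p (fun j => (e j - (j == i))%N) else 0.
Proof.
elim: n p => // n IH p; rewrite ltnS leq_eqVlt => /orP[/eqP ->|lt] /=.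
  rewrite eqxx coefMX; case: (e n) => [|m] /=; first by rewrite mcoef0.
  rewrite subn1; apply: eq_mcoef => j jn.
  by rewrite (ltn_eqF jn) subn0.
have /negPf in_ : i != n by rewrite ltn_eqF.
by rewrite in_ coefMC IH // [n == i]eq_sym in_ subn0.
Qed.

Definition linear_form n (a : {ffun 'I_n -> bool}) : tower n :=
  \sum_(i < n) (if a i then tvar n i else 0).

End Tower.

(** * A combinatorial Borsuk-Ulam theorem for products of spheres *)

Section Grid.
Local Open Scope ring_scope.
Variables (k d n : nat).
Hypothesis n_gt0 : (0 < n)%N.

(** The grid [-2n, 2n] shifted by 2n: even numbers are the vertices and odd
    numbers the open edges of a subdivided segment, so that a product of
    coordinates is a cell of the subdivided cube. *)
Definition coord := 'I_(4 * n).+1.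
Definition origin : coord := inord (2 * n).
Definition extremal (a : coord) : bool :=
  ((a : nat) == 0%N) || ((a : nat) == (4 * n)%N).
(** The edge b has the vertex a as an end point. *)
Definition up (a b : coord) : bool :=
  [&& ~~ odd a, odd b & ((b : nat) == a.+1) || ((a : nat) == b.+1)].

Definition block := {ffun 'I_d.+1 -> coord}.
Definition cell := {ffun 'I_k -> block}.
Definition pos := ('I_k * 'I_d.+1)%type.

Definition updb (w : block) c x : block :=
  [ffun c' => if c' == c then x else w c'].
Definition upd (u : cell) (p : pos) x : cell :=
  [ffun i => if i == p.1 then updb (u i) p.2 x else u i].
Definition entry (u : cell) (p : pos) : coord := u p.1 p.2.

Lemma entry_upd u p x q : entry (upd u p x) q = if q == p then x else entry u q.
Proof.
rewrite /entry ffunE; case: p q => [i c] [j e] /=; rewrite xpair_eqE.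
by case: eqP => //= ->; rewrite ffunE.
Qed.

Lemma cell_eqP (u v : cell) : (forall p, entry u p = entry v p) -> u = v.
Proof. by move=> uv; apply/ffunP=> i; apply/ffunP=> c; apply: (uv (i, c)). Qed.

Lemma upd_comm u p x q y : p != q ->
  upd (upd u p x) q y = upd (upd u q y) p x.
Proof.
move=> pq; apply: cell_eqP => r; rewrite !entry_upd.
by case: (eqVneq r q) => [->|//]; rewrite eq_sym (negPf pq).
Qed.

Lemma upd_upd u p x y : upd (upd u p x) p y = upd u p y.
Proof. by apply: cell_eqP => r; rewrite !entry_upd; case: eqP. Qed.

Lemma upd_id u p : upd u p (entry u p) = u.
Proof. by apply: cell_eqP => r; rewrite !entry_upd; case: eqP => // ->. Qed.

(** The sum of h over the cells that have u as a facet, in the whole cube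
    complex. Functions supported on the product of the cube boundaries
    (see [on_sphere]) need no further restriction: if a coface lies in that
    product then so does u. *)
Definition cofaces (h : cell -> 'F_2) (u : cell) : 'F_2 :=
  \sum_p \sum_(x | up (entry u p) x) h (upd u p x).

Lemma cofacesD h h' :
  cofaces (fun v => h v + h' v) = fun u => cofaces h u + cofaces h' u.
Proof.
apply/funext=> u; rewrite /cofaces -big_split /=.
by apply: eq_bigr => p _; rewrite -big_split.
Qed.

(** Moving up twice changes two different coordinates, in either order. *)
Lemma cofaces_cofaces h : cofaces (cofaces h) = fun=> 0.
Proof.
apply/funext=> u; rewrite /cofaces.
under eq_bigr do rewrite exchange_big /=.
apply: sum_symmetric_offdiag => [p q|p]; last first.
  rewrite big1 // => x /and3P[_ ox _]; rewrite big1 // => y.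
  by rewrite entry_upd eqxx /up ox.
have [->//|pq] := eqVneq p q.
under eq_bigr do under eq_bigl do rewrite entry_upd eq_sym (negPf pq).
under [RHS]eq_bigr do under eq_bigl do rewrite entry_upd (negPf pq).
rewrite [RHS]exchange_big /=; apply: eq_bigr => x _; apply: eq_bigr => y _.
by rewrite upd_comm.
Qed.

(** The commutator of [cofaces] with the multiplication by s. At u it is the
    sum of h over the cofaces across which s changes ([commutatorE]). *)
Definition commutator (s h : cell -> 'F_2) (u : cell) : 'F_2 :=
  s u * cofaces h u + cofaces (fun v => s v * h v) u.

Lemma commutatorE s h u : commutator s h u =
  \sum_p \sum_(x | up (entry u p) x) (s u + s (upd u p x)) * h (upd u p x).
Proof.
rewrite /commutator /cofaces mulr_sumr -big_split /=; apply: eq_bigr => p _.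
by rewrite mulr_sumr -big_split /=; apply: eq_bigr => x _; rewrite mulrDl.
Qed.

Lemma commutatorDl s s' h u :
  commutator (fun v => s v + s' v) h u = commutator s h u + commutator s' h u.
Proof.
rewrite !commutatorE -big_split /=; apply: eq_bigr => p _.
by rewrite -big_split /=; apply: eq_bigr => x _; ring.
Qed.

Lemma commutator0 s : commutator s (fun=> 0) = fun=> 0.
Proof.
by apply/funext=> u; rewrite commutatorE big1 // => p _; rewrite big1 // => x _; rewrite mulr0.
Qed.

Lemma commutatorD s h h' :
  commutator s (fun v => h v + h' v) = fun u => commutator s h u + commutator s h' u.
Proof.
apply/funext=> u; rewrite !commutatorE -big_split /=; apply: eq_bigr => p _.
by rewrite -big_split /=; apply: eq_bigr => x _; ring.
Qed.

Lemma cofaces_commutator s h : cofaces (commutator s h) = commutator s (cofaces h).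
Proof.
by rewrite [LHS]cofacesD cofaces_cofaces /commutator; apply/funext=> u;
  rewrite cofaces_cofaces mulr0 addr0 add0r.
Qed.

(** For ss = [:: s_1; ...; s_N], the value at u is the sum of h over the ends
    of the ascending chains from u in which s_i changes at step i. *)
Definition sweep (ss : seq (cell -> 'F_2)) h := foldr commutator h ss.

Lemma sweep0 ss : sweep ss (fun=> 0) = fun=> 0.
Proof. by elim: ss => //= s ss ->; rewrite commutator0. Qed.

Lemma sweepD ss h h' :
  sweep ss (fun v => h v + h' v) = fun u => sweep ss h u + sweep ss h' u.
Proof. by elim: ss => //= s ss ->; rewrite commutatorD. Qed.

Lemma cofaces_sweep ss h : cofaces (sweep ss h) = sweep ss (cofaces h).
Proof. by elim: ss => //= s ss <-; rewrite cofaces_commutator. Qed.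

Definition sign_group := {ffun 'I_k -> bool}.
Definition flipb (b : bool) (a : coord) : coord := if b then rev_ord a else a.
Definition flip (g : sign_group) (u : cell) : cell :=
  [ffun i => [ffun c => flipb (g i) (u i c)]].

Lemma entry_flip g u p : entry (flip g u) p = flipb (g p.1) (entry u p).
Proof. by rewrite /entry !ffunE. Qed.

Lemma flipbK b : involutive (flipb b).
Proof. by case: b => // a; rewrite /flipb rev_ordK. Qed.

Lemma flipK g : involutive (flip g).
Proof. by move=> u; apply: cell_eqP => p; rewrite !entry_flip flipbK. Qed.

Lemma flip_upd g u p x : flip g (upd u p x) = upd (flip g u) p (flipb (g p.1) x).
Proof.
by apply: cell_eqP => q; rewrite entry_flip !entry_upd entry_flip; case: eqP => // ->.
Qed.

Lemma odd_flipb b a : odd (flipb b a) = odd a.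
Proof. by case: b; rewrite //= subSS; case: a => a /= ?; lia. Qed.

Lemma extremal_flipb b a : extremal (flipb b a) = extremal a.
Proof. by case: b; rewrite // /extremal /= subSS; case: a => a /= ?; lia. Qed.

Lemma up_flipb b x y : up (flipb b x) (flipb b y) = up x y.
Proof.
rewrite /up !odd_flipb; case: b => //=; rewrite !subSS.
case: x y => x /= ? [y /= ?]; congr [&& _, _ & _]; lia.
Qed.

Lemma flipb_origin b a : (flipb b a == origin) = (a == origin).
Proof.
case: b => //; rewrite -!val_eqE /= inordK; last lia.
by case: a => a /= ?; lia.
Qed.

(** In each of the k blocks some coordinate is extremal: the cell lies in the
    product of the boundaries of k cubes of dimension d + 1, that is, in a
    product of k spheres of dimension d. *)
Definition on_sphere (u : cell) := [forall i, exists c, extremal (u i c)].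
Definition vertex (u : cell) := [forall p, ~~ odd (entry u p)].

Lemma on_sphere_flip g u : on_sphere (flip g u) = on_sphere u.
Proof.
by apply: eq_forallb => i; apply: eq_existsb => c; rewrite !ffunE extremal_flipb.
Qed.

Lemma vertex_flip g u : vertex (flip g u) = vertex u.
Proof. by apply: eq_forallb => p; rewrite entry_flip odd_flipb. Qed.

Lemma extremal_odd a : extremal a -> odd a = false.
Proof. by rewrite /extremal; case: a => a /= ?; lia. Qed.

Lemma up_odd a x : up a x -> odd x.
Proof. by case/and3P. Qed.

(** The sphere is closed under faces, because an extremal coordinate is even
    and a face is obtained by making an odd coordinate even. *)
Lemma on_sphere_upd u p (x : coord) : odd x -> on_sphere (upd u p x) -> on_sphere u.
Proof.
move=> ox /forallP vu; apply/forallP => i; have /existsP[c ec] := vu i.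
apply/existsP; exists c; move: ec.
have -> : upd u p x i c = entry (upd u p x) (i, c) by [].
rewrite entry_upd; case: eqP => // _ /extremal_odd; by rewrite ox.
Qed.

Definition supported (h : cell -> 'F_2) := forall u, ~~ on_sphere u -> h u = 0.
Definition invariant (h : cell -> 'F_2) := forall g u, h (flip g u) = h u.

Lemma supported_cofaces h : supported h -> supported (cofaces h).
Proof.
move=> hs u nu; rewrite /cofaces big1 // => p _; rewrite big1 // => x ux.
by apply: hs; apply: contra nu; apply: on_sphere_upd; apply: up_odd ux.
Qed.

Lemma val_origin : origin = (2 * n)%N :> nat.
Proof. by rewrite inordK //; lia. Qed.

Definition leads (w : block) (c : 'I_d.+1) :=
  (w c != origin) && [forall e : 'I_d.+1, (e < c)%N ==> (w e == origin)].
(** An equivariant choice of sign for the blocks that are not zero. *)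
Definition neg_lead (w : block) : bool :=
  if [pick c | leads w c] is Some c then (w c < 2 * n)%N else false.
Definition signs (u : cell) : sign_group := [ffun i => neg_lead (u i)].

Lemma leads_uniq w c c' : leads w c -> leads w c' -> c = c'.
Proof.
move=> /andP[wc /forallP cmin] /andP[wc' /forallP c'min]; apply/val_inj => /=.
case: (ltngtP c c') => // lt; exfalso.
  by have /implyP/(_ lt) := c'min c; rewrite (negPf wc).
by have /implyP/(_ lt) := cmin c'; rewrite (negPf wc').
Qed.

Lemma neg_leadE w c : leads w c -> neg_lead w = (w c < 2 * n)%N.
Proof.
rewrite /neg_lead => wc; case: pickP => [c' wc'|/(_ c)]; last by rewrite wc.
by rewrite (leads_uniq wc wc').
Qed.

Lemma leads_ex (w : block) c : w c != origin -> exists2 e, leads w e & (e <= c)%N.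
Proof.
move=> wc; case: (@arg_minnP _ c (fun c => w c != origin) val wc) => e we emin.
exists e; last exact: emin.
rewrite /leads we; apply/forallP => f; apply/implyP; apply: contraLR => wf.
by rewrite -leqNgt emin.
Qed.

Lemma extremal_origin : extremal origin = false.
Proof. by rewrite /extremal val_origin; lia. Qed.

Lemma neg_lead_flip b (w : block) c : w c != origin ->
  neg_lead [ffun c => flipb b (w c)] = neg_lead w (+) b.
Proof.
move=> /leads_ex[e we _].
rewrite (neg_leadE we) (@neg_leadE _ e) ?ffunE; last first.
  move: we; rewrite /leads ffunE flipb_origin; congr (_ && _).
  by apply: eq_forallb => f; rewrite ffunE flipb_origin.
case/andP: we; rewrite -(inj_eq val_inj) /= val_origin => + _.
by case: b => /=; case: (w e) => a /= ?; rewrite ?subSS; lia.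
Qed.

Lemma signs_flip g u : on_sphere u -> signs (flip g u) = [ffun i => signs u i (+) g i].
Proof.
move=> /forallP vu; apply/ffunP => i; rewrite !ffunE.
have /existsP[c ec] := vu i; rewrite (@neg_lead_flip _ _ c) //.
by apply: contraTneq ec => ->; rewrite extremal_origin.
Qed.

(** The sum over one vertex of each orbit: on the product of spheres, each orbit
    of vertices meets the set where all leading coordinates are positive once.
    Summing over all vertices would lose all information, because orbits have
    2^k elements. *)
Definition rho (h : cell -> 'F_2) : 'F_2 :=
  \sum_(u | vertex u && (signs u == [ffun=> false])) h u.

(** If v is an edge, the number of its end points that have sign vector g; other
    cells have no facet that is a vertex. *)
Definition facet_weight (g : sign_group) (v : cell) : 'F_2 :=
  \sum_p \sum_(y | up y (entry v p))
     (vertex (upd v p y) && (signs (upd v p y) == g))%:R.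

Lemma sum_up_below (x : coord) : \sum_(y | up y x) (1 : 'F_2) = 0.
Proof.
case ox: (odd x); last by rewrite big1 // => y /and3P[]; rewrite ox.
have xlt := ltn_ord x.
have lt1 : (x.-1 < (4 * n).+1)%N by lia.
have lt2 : (x.+1 < (4 * n).+1)%N by move: ox; case: (x) xlt => a /= ?; lia.
rewrite (bigD1 (Ordinal lt1)) /=; last by rewrite /up ox /=; lia.
rewrite (bigD1 (Ordinal lt2)) /=; last first.
  by rewrite /up ox -(inj_eq val_inj) /=; lia.
rewrite big1 ?addr0 ?F2_addrr // => y /andP[/andP[]].
rewrite /up ox -!(inj_eq val_inj) /=; case: y => y /=; lia.
Qed.

Lemma sum_facet_weight v : \sum_g facet_weight g v = 0.
Proof.
rewrite exchange_big /= big1 // => p _; rewrite exchange_big /=.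
transitivity ([forall q, (q != p) ==> ~~ odd (entry v q)]%:R
    * \sum_(y | up y (entry v p)) (1 : 'F_2)); last by rewrite sum_up_below mulr0.
rewrite mulr_sumr; apply: eq_bigr => y uy; rewrite mulr1.
rewrite (bigD1 (signs (upd v p y))) //= eqxx andbT big1 ?addr0; last first.
  by move=> g /negPf; rewrite eq_sym => ->; rewrite andbF.
congr (nat_of_bool _)%:R; apply: eq_forallb => q; rewrite entry_upd.
by case: eqP => //= _; case/and3P: uy.
Qed.

Lemma facet_weight_flip g g' v : on_sphere v ->
  facet_weight g (flip g' v) = facet_weight [ffun i => g i (+) g' i] v.
Proof.
move=> vv; apply: eq_bigr => p _.
rewrite (reindex_inj (inv_inj (flipbK (g' p.1)))) /=; apply: eq_big => x.
  by rewrite entry_flip up_flipb.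
move=> ux; rewrite -flip_upd vertex_flip; case vx: (vertex _) => //=.
rewrite signs_flip; last first.
  rewrite -(upd_id v p) -(upd_upd v p x) in vv.
  apply: on_sphere_upd vv; apply: up_odd.
  by move: ux; rewrite entry_flip up_flipb; exact.
congr (nat_of_bool _)%:R; apply/eqP/eqP => [<-|->]; apply/ffunP => i; rewrite !ffunE;
  by case: (g' i); rewrite ?addbF ?addbT ?negbK.
Qed.

(** Stokes: after exchanging the sums, [rho] counts the end points of edges, and
    by invariance each orbit of edges may be represented by one edge with both
    of its end points, whatever their signs. *)
Lemma rho_cofaces h : supported h -> invariant h -> rho (cofaces h) = 0.
Proof.
move=> hs hi.
have -> : rho (cofaces h) = \sum_v h v * facet_weight [ffun=> false] v.
  rewrite /rho big_mkcond /=.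
  transitivity (\sum_p \sum_u \sum_(x | up (entry u p) x)
     (vertex u && (signs u == [ffun=> false]))%:R * h (upd u p x)).
    rewrite [RHS]exchange_big /=; apply: eq_bigr => u _.
    case: ifP => _; last first.
      by rewrite big1 // => p _; rewrite big1 // => x _; rewrite mulr0n mul0r.
    rewrite /cofaces; apply: eq_bigr => p _; apply: eq_bigr => x _.
    by rewrite mulr1n mul1r.
  rewrite /facet_weight; under [RHS]eq_bigr do rewrite mulr_sumr.
  rewrite [RHS]exchange_big /=; apply: eq_bigr => p _.
  under [RHS]eq_bigr do rewrite mulr_sumr.
  rewrite !pair_big_dep /=.
  (* swaps a pair (facet, coface) described from below with one from above *)
  pose f (ux : cell * coord) := (upd ux.1 p ux.2, entry ux.1 p).
  have fK : involutive f.
    by case=> u x; rewrite /f /= entry_upd eqxx upd_upd upd_id.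
  rewrite (reindex_inj (inv_inj fK)) /=; apply: eq_big => -[v y] /=.
    by rewrite entry_upd eqxx.
  by rewrite upd_upd upd_id mulrC.
rewrite (bigID on_sphere) /= [X in _ + X]big1 ?addr0; last first.
  by move=> v nv; rewrite hs ?mul0r.
rewrite (partition_big signs xpredT) //=.
transitivity (\sum_g \sum_(v | on_sphere v && (signs v == [ffun=> false]))
   h v * facet_weight g v).
  apply: eq_bigr => g _; rewrite (reindex_inj (inv_inj (flipK g))) /=.
  apply: eq_big => v.
    rewrite on_sphere_flip; case vv: (on_sphere v) => //=; rewrite signs_flip //.
    apply/eqP/eqP => [/ffunP e|->]; apply/ffunP => i; rewrite !ffunE //=.
    by move: (e i); rewrite !ffunE; case: (g i); case: (neg_lead _).
  case/andP; rewrite on_sphere_flip => vv _; rewrite hi facet_weight_flip //.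
  by congr (_ * facet_weight _ _); apply/ffunP => i; rewrite !ffunE.
rewrite exchange_big /= big1 // => v _.
by rewrite -mulr_sumr sum_facet_weight mulr0.
Qed.

Definition dot (a g : sign_group) : bool := \big[addb/false]_i (a i && g i).
(** A cell with a zero block is fixed by the flip of that block, which is why the
    condition is restricted to cells on the sphere. *)
Definition equivariant (a : sign_group) (s : cell -> 'F_2) :=
  forall g u, on_sphere u -> s (flip g u) = s u + (dot a g)%:R.

Lemma dotE a g : (dot a g)%:R = \sum_i (a i && g i)%:R :> 'F_2.
Proof. exact: (big_morph (fun b : bool => b%:R) F2_natb_add). Qed.

Lemma supportedM s h : supported h -> supported (fun v => s v * h v).
Proof. by move=> hs u /hs ->; rewrite mulr0. Qed.

Lemma supported_commutator s h : supported h -> supported (commutator s h).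
Proof.
move=> hs u nu; rewrite /commutator !supported_cofaces ?mulr0 ?addr0 //.
exact: supportedM.
Qed.

Lemma invariant_commutator a s h : equivariant a s -> supported h -> invariant h ->
  invariant (commutator s h).
Proof.
move=> sa hs hi g u; rewrite !commutatorE; apply: eq_bigr => p _.
rewrite (reindex_inj (inv_inj (flipbK (g p.1)))) /=; apply: eq_big => x.
  by rewrite entry_flip up_flipb.
rewrite entry_flip up_flipb => ux; rewrite -flip_upd hi.
case vv: (on_sphere (upd u p x)); last by rewrite hs ?vv // !mulr0.
rewrite !sa ?(on_sphere_upd (up_odd ux) vv) //; congr (_ * _).
rewrite addrACA F2_addrr addr0 //.
Qed.

Lemma sweep_inv_supp (J : Type) (a : J -> sign_group) (S : J -> cell -> 'F_2) L h :
  (forall j, equivariant (a j) (S j)) -> supported h -> invariant h ->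
  supported (sweep (map S L) h) /\ invariant (sweep (map S L) h).
Proof.
move=> Sa hs hi; elim: L => //= j L [IHs IHi]; split.
  exact: supported_commutator.
exact: invariant_commutator (Sa j) IHs IHi.
Qed.

Lemma rhoD h h' : rho (fun u => h u + h' u) = rho h + rho h'.
Proof. exact: big_split. Qed.

(** The functions are exchanged one at a time. The sum r of two functions with
    the same character is invariant, and the commutator of r with Z, where
    cofaces Z = 0, is cofaces (r Z); being a coboundary, it commutes with the
    remaining commutators and is killed by [rho]. *)
Lemma rho_sweep_swap (J : Type) (a : J -> sign_group) (S S' : J -> cell -> 'F_2) L h :
  (forall j, equivariant (a j) (S j)) -> (forall j, equivariant (a j) (S' j)) ->
  supported h -> invariant h -> cofaces h = (fun=> 0) ->
  rho (sweep (map S L) h) = rho (sweep (map S' L) h).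
Proof.
move=> Sa Sa' hs hi h0.
suff swap (pre : seq J) : rho (sweep (map S' pre) (sweep (map S L) h)) =
    rho (sweep (map S' pre) (sweep (map S' L) h)) by exact: (swap [::]).
elim: L pre => //= j L IH pre.
transitivity (rho (sweep (map S' (rcons pre j)) (sweep (map S L) h))); last first.
  by rewrite IH map_rcons /sweep foldr_rcons.
rewrite map_rcons {3}/sweep foldr_rcons -/(sweep _ _).
have [] := sweep_inv_supp L Sa hs hi.
have : cofaces (sweep (map S L) h) = fun=> 0 by rewrite cofaces_sweep h0 sweep0.
move: (sweep _ h) => Z Z0 Zs Zi.
pose r u := S j u + S' j u.
have -> : commutator (S j) Z = fun u => commutator (S' j) Z u + cofaces (fun v => r v * Z v) u.
  apply/funext => u; have -> : cofaces (fun v => r v * Z v) u = commutator r Z u.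
    by rewrite /commutator Z0 mulr0 add0r.
  by rewrite commutatorDl addrC -addrA F2_addrr addr0.
have rZs : supported (fun v => r v * Z v) by exact: supportedM.
have rZi : invariant (fun v => r v * Z v).
  move=> g u; case vu: (on_sphere u); last by rewrite !Zs ?on_sphere_flip ?vu // !mulr0.
  by rewrite /r Sa // Sa' // Zi addrACA F2_addrr addr0.
have [prs pri] := sweep_inv_supp pre Sa' rZs rZi.
by rewrite sweepD rhoD -cofaces_sweep rho_cofaces // addr0.
Qed.

Definition profile (e : nat) (w : block) (c0 : 'I_d.+1) : bool :=
  extremal (w c0) &&
  [forall c, (c != c0) ==> if (c < e)%N then w c == origin else odd (w c)].
(** Modulo 2, whether the coordinates of w from e on form a top cell of the
    boundary of a cube, the ones before e being zero. For e = 0 these are the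
    top cells of a sphere, for e = d two antipodal vertices. *)
Definition suffix_top (e : nat) (w : block) : 'F_2 :=
  \sum_(c0 : 'I_d.+1 | (e <= c0)%N) (profile e w c0)%:R.
Definition lead_sign (w : block) : 'F_2 := (neg_lead w)%:R.

Lemma suffix_top_neq0 e w : suffix_top e w != 0 -> exists2 c0 : 'I_d.+1, (e <= c0)%N & profile e w c0.
Proof.
move=> Hw; case: (pickP [pred c0 : 'I_d.+1 | (e <= c0)%N && profile e w c0]).
  by move=> c0 /andP[]; exists c0.
move=> no; case/eqP: Hw; rewrite /suffix_top big1 // => c0 ec0.
by move: (no c0); rewrite /= ec0 /= => ->.
Qed.

Lemma odd_origin : odd origin = false.
Proof. by rewrite val_origin; lia. Qed.

Lemma suffix_top_leads (e : 'I_d.+1) w : suffix_top e w != 0 -> leads w e.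
Proof.
case/suffix_top_neq0 => c0 ec0 /andP[xc0 /forallP prof]; apply/andP; split.
  have [->|ne] := eqVneq e c0.
    by apply: contraTneq xc0 => ->; rewrite extremal_origin.
  have /implyP/(_ ne) := prof e.
  by rewrite ltnn; apply: contraTneq => ->; rewrite odd_origin.
apply/forallP => c; apply/implyP => ce; have /implyP := prof c; rewrite ce.
by apply; rewrite neq_ltn (leq_trans ce ec0).
Qed.

Lemma sum_up_above (a : coord) : \sum_(x | up a x) (1 : 'F_2) = (extremal a)%:R.
Proof.
have alt := ltn_ord a.
case oa: (odd a).
  by rewrite big1 ?extremal_odd /extremal ?oa // => [|x /and3P[]]; rewrite ?oa //;
    case: eqP => [a0|_]; case: eqP => [a1|_] //; move: oa; rewrite ?a0 ?a1; lia.
rewrite /extremal; case: eqP => [a0|a0].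
  have lt1 : (a.+1 < (4 * n).+1)%N by lia.
  rewrite (bigD1 (Ordinal lt1)) /=; last by rewrite /up oa /= oa eqxx.
  rewrite big1 ?addr0 // => y /andP[].
  rewrite /up oa -!(inj_eq val_inj) /=; case: y => y /=; lia.
have lt0 : (a.-1 < (4 * n).+1)%N by lia.
have up0 : up a (Ordinal lt0).
  rewrite /up oa /=; move: oa a0; case: (a) => b /= ?; lia.
rewrite (bigD1 (Ordinal lt0)) //=; case: eqP => [a1|a1].
  rewrite big1 ?addr0 // => y /andP[].
  rewrite /up oa -!(inj_eq val_inj) /=; case: y => y /=; lia.
have lt1 : (a.+1 < (4 * n).+1)%N by lia.
rewrite (bigD1 (Ordinal lt1)) /=; last first.
  by rewrite /up oa -(inj_eq val_inj) /= oa eqxx /=; lia.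
rewrite big1 ?addr0 ?F2_addrr // => y /andP[/andP[]].
rewrite /up oa -!(inj_eq val_inj) /=; case: y => y /=; lia.
Qed.

(** A cell of codimension 1 lies in two top cells. Moving coordinate c to an odd
    value while c0 stays extremal can be done in one way if c is extremal, and
    in no way or two ways otherwise; so only pairs of extremal coordinates count, and
    they are symmetric. *)
Lemma sum_cofaces_suffix_top0 (w : block) :
  \sum_c \sum_(x | up (w c) x) suffix_top 0 (updb w c x) = 0.
Proof.
pose G (c c0 : 'I_d.+1) : 'F_2 := ([&& c != c0, extremal (w c), extremal (w c0) &
  [forall c', (c' != c) ==> (c' != c0) ==> odd (w c')]])%:R.
rewrite -[RHS](@sum_symmetric_offdiag _ G); first last.
- by move=> c; rewrite /G eqxx.
- move=> c c0; rewrite /G eq_sym; congr (nat_of_bool _)%:R.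
  congr (_ && _); rewrite andbCA; congr [&& _, _ & _].
  by apply: eq_forallb => c'; rewrite !implybE orbCA.
apply: eq_bigr => c _.
rewrite exchange_big /=; apply: eq_bigr => c0 _.
have [<-|cc0] := eqVneq c c0.
  rewrite /G eqxx big1 // => x /up_odd ox; rewrite /profile ffunE eqxx.
  by case: (boolP (extremal x)) => // /extremal_odd; rewrite ox.
transitivity (\sum_(x | up (w c) x) (1 : 'F_2) *
   (extremal (w c0) &&
    [forall c', (c' != c) ==> (c' != c0) ==> odd (w c')])%:R).
  apply: eq_bigr => x ux; rewrite mul1r /profile ffunE eq_sym (negPf cc0).
  congr (nat_of_bool (_ && _))%:R; apply: eq_forallb => c'; rewrite ffunE.
  have [->|_] := eqVneq c' c; last by [].
  by rewrite (up_odd ux) implybT.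
rewrite -mulr_suml sum_up_above /G cc0 /=.
by case: (extremal (w c)); rewrite ?mul1r // mul0r.
Qed.

(** The sign of the leading coordinate changes only if a coordinate before it
    becomes nonzero. The new leading position is e, so the coordinates of w up to
    e are zero, and just one of the two directions in which to leave zero changes
    the sign. *)
Lemma sum_sign_changes_suffix_top e (w : block) :
  \sum_c \sum_(x | up (w c) x) (lead_sign w + lead_sign (updb w c x)) * suffix_top e (updb w c x)
  = suffix_top e.+1 w.
Proof.
have zero (c : 'I_d.+1) (x : coord) : up (w c) x -> (c : nat) != e \/ w c != origin ->
    (lead_sign w + lead_sign (updb w c x)) * suffix_top e (updb w c x) = 0.
  move=> ux ce; have [->|Hv] := eqVneq (suffix_top e (updb w c x)) 0; first by rewrite mulr0.
  have [c0 ec0 prof] := suffix_top_neq0 Hv.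
  have ltd : (e < d.+1)%N by exact: leq_ltn_trans ec0 (ltn_ord c0).
  have lv := @suffix_top_leads (Ordinal ltd) _ Hv.
  suff -> : lead_sign w = lead_sign (updb w c x) by rewrite F2_addrr mul0r.
  rewrite /lead_sign (neg_leadE lv) ffunE.
  have cNe : (e <= c)%N.
    rewrite leqNgt; apply/negP => clt.
    case/andP: lv => _ /forallP/(_ c)/implyP/(_ clt); rewrite ffunE eqxx => /eqP xm.
    by have := up_odd ux; rewrite xm odd_origin.
  have lw : leads w (Ordinal ltd).
    move: lv; rewrite /leads ffunE => /andP[v1 v2]; apply/andP; split.
      case: (Ordinal ltd =P c) v1 => [ceq _|//]; rewrite ceq; case: ce => [|//].
      by rewrite -ceq /= eqxx.
    apply/forallP => f; apply/implyP => fe; have /forallP/(_ f)/implyP/(_ fe) := v2.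
    by rewrite ffunE; case: (f =P c) => // fc; move: fe; rewrite fc /= ltnNge cNe.
  rewrite (neg_leadE lw); case: (Ordinal ltd =P c) => // ceq.
  case: ce; first by rewrite -ceq /= eqxx.
  rewrite ceq => wm; case/and3P: ux => ev ox.
  move: wm; rewrite -(inj_eq val_inj) /= val_origin => wm xw; congr (nat_of_bool _)%:R.
  by lia.
have [ltd|ged] := ltnP e d.+1; last first.
  rewrite big1 => [|c _]; last first.
    rewrite big1 // => x ux; apply: zero => //; left.
    by rewrite ltn_eqF // (leq_trans (ltn_ord c)).
  rewrite /suffix_top big1 // => c0 ec0.
  by have := leq_trans ec0 (ltnW (ltn_ord c0)); lia.
pose ce := Ordinal ltd.
rewrite (bigD1 ce) //= [X in _ + X]big1 ?addr0; last first.
  move=> c cne; rewrite big1 // => x ux; apply: zero => //; left.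
  by rewrite -(inj_eq val_inj) in cne.
have [wm|wm] := eqVneq (w ce) origin; last first.
  rewrite big1 => [|x ux]; last by apply: zero => //; right.
  rewrite /suffix_top big1 // => c0 ec0; case: (boolP (profile _ _ _)) => //.
  case/andP => _ /forallP/(_ ce)/implyP; rewrite ltnSn (negPf wm) => prof.
  suff /prof : ce != c0 by [].
  by rewrite -(inj_eq val_inj) /= neq_ltn ec0.
have HK (x : coord) : odd x -> suffix_top e (updb w ce x) = suffix_top e.+1 w.
  move=> ox; rewrite /suffix_top (bigID (fun c0 : 'I_d.+1 => c0 == ce)) /=.
  rewrite [X in X + _]big1 ?add0r; last first.
    move=> c0 /andP[_ /eqP ->]; rewrite /profile ffunE eqxx.
    by case: (boolP (extremal x)) => // /extremal_odd; rewrite ox.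
  apply: eq_big => c0.
    by rewrite -(inj_eq val_inj) /= ltn_neqAle eq_sym andbC.
  case/andP => _ c0ce; rewrite /profile ffunE (negPf c0ce).
  congr (nat_of_bool (_ && _))%:R; apply: eq_forallb => c; rewrite ffunE.
  have [->|cce] := eqVneq c ce; first by rewrite /= ltnn ltnSn wm eqxx ox.
  rewrite ltnS [in RHS]leq_eqVlt; move: cce; rewrite -(inj_eq val_inj) /= => cce.
  by rewrite (negPf cce).
rewrite wm; have [H0|Hn0] := eqVneq (suffix_top e.+1 w) 0.
  by rewrite H0 big1 // => x /up_odd ox; rewrite HK // H0 mulr0.
transitivity (\sum_(x | up origin x) (lead_sign w + ((x : nat) < 2 * n)%N%:R) * suffix_top e.+1 w).
  apply: eq_bigr => x /up_odd ox; rewrite HK // /lead_sign.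
  have := @suffix_top_leads ce (updb w ce x); rewrite HK // => /(_ Hn0) /neg_leadE ->.
  by rewrite ffunE eqxx.
rewrite -mulr_suml big_split /= -[lead_sign w]mul1r -mulr_suml sum_up_above extremal_origin.
rewrite mulr0n mul0r add0r.
have lt0 : ((2 * n).-1 < (4 * n).+1)%N by lia.
rewrite (bigD1 (Ordinal lt0)) /=; last by rewrite /up val_origin /=; lia.
rewrite big1 ?addr0.
  by rewrite (_ : ((2 * n).-1 < 2 * n)%N = true) ?mul1r //; lia.
move=> y /andP[]; rewrite /up val_origin -!(inj_eq val_inj) /=; case: y => y /= _.
by move=> uy yn; rewrite (_ : (y < 2 * n)%N = false) //; lia.
Qed.

Lemma sum_vertex_suffix_top e :
  \sum_(w : block | [forall c, ~~ odd (w c)] && ~~ neg_lead w) suffix_top e w = (e == d)%:R.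
Proof.
rewrite exchange_big /=.
have none (c0 : 'I_d.+1) (w : block) : (e <= c0)%N -> [forall c, ~~ odd (w c)] -> profile e w c0 ->
    forall c : 'I_d.+1, (e <= c)%N -> c = c0.
  move=> ec0 /forallP ew /andP[_ /forallP prof] c ec; apply/eqP/negP => /negP ne.
  by have /implyP/(_ ne) := prof c; rewrite ltnNge ec /= (negPf (ew c)).
have [->|ed] := eqVneq e d; last first.
  rewrite big1 // => c0 ec0; rewrite big1 // => w /andP[ew _].
  case: (boolP (profile e w c0)) => // prof.
  have lt : (e < d.+1)%N by apply: leq_ltn_trans ec0 (ltn_ord c0).
  have := none _ _ ec0 ew prof (Ordinal lt) (leqnn _).
  have <- := none _ _ ec0 ew prof ord_max lt.
  by move/(congr1 val) => /= /eqP; rewrite (negPf ed).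
rewrite (bigD1 ord_max) //= [X in _ + X]big1 ?addr0; last first.
  move=> c0 /andP[dc0]; rewrite -(inj_eq val_inj) /= => cd.
  by have := ltn_ord c0; rewrite ltnS leq_eqVlt (negPf cd) ltnNge dc0.
pose w0 : block := [ffun c => if c == ord_max then ord_max else origin].
have lead0 w : profile d w ord_max -> leads w ord_max.
  case/andP => x /forallP prof; apply/andP; split.
    by apply: contraTneq x => ->; rewrite extremal_origin.
  apply/forallP => c; apply/implyP => cd; have /implyP := prof c.
  by rewrite cd; apply; rewrite -(inj_eq val_inj) /= ltn_eqF.
have prof0 : profile d w0 ord_max.
  apply/andP; split; first by rewrite ffunE eqxx /extremal /= eqxx orbT.
  apply/forallP => c; apply/implyP => cm; rewrite ffunE (negPf cm) eqxx ifT //.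
  by rewrite ltn_neqAle -ltnS ltn_ord andbT -(inj_eq val_inj) /= in cm *.
rewrite (bigD1 w0) /=; last first.
  rewrite (neg_leadE (lead0 _ prof0)) ffunE eqxx /= -leqNgt; apply/andP; split; last by lia.
  apply/forallP => c; rewrite ffunE; case: ifP => _ /=; last by rewrite odd_origin.
  by rewrite oddM.
rewrite prof0 big1 ?addr0 // => w /andP[/andP[_ nw] ww0].
case: (boolP (profile d w ord_max)) => // prof; case/eqP: ww0.
move: nw; rewrite (neg_leadE (lead0 _ prof)).
case/andP: prof => xw /forallP prof nw; apply/ffunP => c; rewrite ffunE.
case: eqP => [->|/eqP cm].
  apply/val_inj; move: xw nw; rewrite /extremal /=; case: (w _) => a /=; lia.
have /implyP/(_ cm) := prof c; rewrite ifT => [/eqP //|].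
by rewrite ltn_neqAle -ltnS ltn_ord andbT -(inj_eq val_inj) /= in cm *.
Qed.

(** The exponents e record how many sign changes have been made in each block. *)
Definition suffix_top_cell (e : nat -> nat) (u : cell) : 'F_2 := \prod_(i < k) suffix_top (e i) (u i).

Lemma suffix_top_cell_upd e u i c x : suffix_top_cell e (upd u (i, c) x) =
  suffix_top (e i) (updb (u i) c x) * \prod_(j < k | j != i) suffix_top (e j) (u j).
Proof.
rewrite /suffix_top_cell (bigD1 i) //= ffunE eqxx; congr (_ * _).
by apply: eq_bigr => j ji; rewrite ffunE /= (negPf ji).
Qed.

Lemma supported_suffix_top_cell e : supported (suffix_top_cell e).
Proof.
move=> u; rewrite negb_forall => /existsP[i]; rewrite negb_exists => /forallP ni.
rewrite /suffix_top_cell (bigD1 i) //=; have [->|] := eqVneq (suffix_top (e i) (u i)) 0.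
  by rewrite mul0r.
by case/suffix_top_neq0 => c0 _ /andP[]; rewrite (negPf (ni c0)).
Qed.

Lemma invariant_suffix_top_cell e : invariant (suffix_top_cell e).
Proof.
move=> g u; rewrite /suffix_top_cell; apply: eq_bigr => i _; rewrite /suffix_top; apply: eq_bigr => c _.
congr (nat_of_bool (_ && _))%:R; first by rewrite !ffunE extremal_flipb.
by apply: eq_forallb => c'; rewrite !ffunE flipb_origin odd_flipb.
Qed.

(** A product of spheres has no boundary. *)
Lemma cofaces_suffix_top_cell0 : cofaces (suffix_top_cell (fun=> 0%N)) = fun=> 0.
Proof.
apply/funext => u; rewrite /cofaces.
rewrite -(pair_bigA _ (fun i c => \sum_(x | up (entry u (i, c)) x)
  suffix_top_cell (fun=> 0%N) (upd u (i, c) x))) /= big1 // => i _.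
transitivity ((\sum_c \sum_(x | up (u i c) x) suffix_top 0 (updb (u i) c x)) *
    \prod_(j < k | j != i) suffix_top 0 (u j)); last by rewrite sum_cofaces_suffix_top0 mul0r.
rewrite mulr_suml; apply: eq_bigr => c _; rewrite mulr_suml.
by apply: eq_bigr => x _; rewrite suffix_top_cell_upd.
Qed.

Lemma commutator_sign_suffix_top_cell e (i : 'I_k) :
  commutator (fun u => lead_sign (u i)) (suffix_top_cell e) = suffix_top_cell (fun j => (e j + (j == i))%N).
Proof.
apply/funext => u; rewrite commutatorE.
rewrite -(pair_bigA _ (fun j c => \sum_(x | up (entry u (j, c)) x)
  (lead_sign (u i) + lead_sign (upd u (j, c) x i)) * suffix_top_cell e (upd u (j, c) x))) /=.
rewrite (bigD1 i) //= [X in _ + X]big1 ?addr0; last first.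
  move=> j ji; rewrite big1 // => c _; rewrite big1 // => x _.
  by rewrite ffunE /= eq_sym (negPf ji) F2_addrr mul0r.
rewrite [RHS](bigD1 i) //= eqxx addn1 -sum_sign_changes_suffix_top mulr_suml.
apply: eq_bigr => c _; rewrite mulr_suml; apply: eq_bigr => x _.
rewrite suffix_top_cell_upd ffunE eqxx -mulrA; congr (_ * (_ * _)).
by apply: eq_bigr => j ji; rewrite (inj_eq val_inj) (negPf ji) addn0.
Qed.

Lemma rho_suffix_top_cell e : rho (suffix_top_cell e) = [forall i : 'I_k, e i == d]%:R.
Proof.
have -> : [forall i : 'I_k, e i == d]%:R = \prod_(i < k) (e i == d)%:R :> 'F_2.
  case: forallP => [all_d|no]; first by rewrite big1 // => i _; rewrite all_d.
  have [i ni] : exists i : 'I_k, e i != d.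
    apply/existsP; rewrite -[X in is_true X]negbK negb_exists; apply/negP.
    by move/forallP => all_d; apply: no => i; rewrite -[_ == _]negbK.
  by rewrite (bigD1 i) //= (negPf ni) mulr0n mul0r.
under [RHS]eq_bigr do rewrite -sum_vertex_suffix_top.
rewrite bigA_distr_big /=; apply: eq_bigl => u.
apply/andP/ffun_onP => /= [[/forallP vu /eqP su] i|all_i].
  apply/andP; split; first by apply/forallP => c; exact: (vu (i, c)).
  by move/ffunP: su => /(_ i); rewrite !ffunE => ->.
split; first by apply/forallP => -[i c]; have /andP[/forallP + _] := all_i i; exact.
by apply/eqP/ffunP => i; rewrite !ffunE; have /andP[_ /negPf] := all_i i.
Qed.

Definition chi (a : sign_group) (u : cell) : 'F_2 := (dot a (signs u))%:R.

Lemma equivariant_chi a : equivariant a (chi a).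
Proof.
move=> g u vu; rewrite /chi signs_flip // !dotE -big_split; apply: eq_bigr => i _.
by rewrite !ffunE /= -F2_natb_add; case: (a i).
Qed.

Lemma commutator_chi a h u : commutator (chi a) h u =
  \sum_i (a i)%:R * commutator (fun u => lead_sign (u i)) h u.
Proof.
rewrite commutatorE; under [RHS]eq_bigr do rewrite commutatorE mulr_sumr.
rewrite exchange_big; apply: eq_bigr => p _ /=.
under [RHS]eq_bigr do rewrite mulr_sumr.
rewrite exchange_big; apply: eq_bigr => x _ /=.
rewrite /chi !dotE -big_split mulr_suml; apply: eq_bigr => i _ /=.
rewrite mulrA; congr (_ * _); rewrite !ffunE /lead_sign.
by case: (a i); rewrite ?mul1r // mul0r addr0.
Qed.

Lemma sweepZ ss (c : 'F_2) h : sweep ss (fun v => c * h v) = fun u => c * sweep ss h u.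
Proof.
elim: ss => //= s ss ->; apply/funext => u; rewrite !commutatorE mulr_sumr.
apply: eq_bigr => p _; rewrite mulr_sumr; apply: eq_bigr => x _.
by rewrite mulrCA.
Qed.

Lemma sweep_sum ss (I : Type) (r : seq I) (h : I -> cell -> 'F_2) u :
  sweep ss (fun v => \sum_(i <- r) h i v) u = \sum_(i <- r) sweep ss (h i) u.
Proof.
elim: r => [|i r IH].
  rewrite big_nil (_ : (fun _ => _) = fun=> 0) ?sweep0 //.
  by apply/funext => v; rewrite big_nil.
rewrite big_cons -IH (_ : (fun _ => _) = fun v => h i v + \sum_(j <- r) h j v).
  by rewrite sweepD.
by apply/funext => v; rewrite big_cons.
Qed.

(** The operators given by the signs of single blocks act as the shifts
    e_i -> e_i + 1 on the functions [suffix_top_cell e], so the sweep is the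
    product of the linear forms applied to the function at e, and [rho] reads
    off the coefficient that leads to e = (d, ..., d). *)
Lemma rho_sweep_chi (chars : seq sign_group) e :
  rho (sweep (map chi chars) (suffix_top_cell e)) =
  if [forall i : 'I_k, (e i <= d)%N]
  then mcoef (\prod_(a <- chars) linear_form a) (fun i => d - e i)%N else 0.
Proof.
elim/last_ind: chars e => [|chars a IH] e.
  rewrite big_nil mcoef1 /= rho_suffix_top_cell.
  case: (boolP [forall i : 'I_k, (e i <= d)%N]) => [/forallP led|no]; last first.
    case: forallP => // all_d; case/negP: no.
    by apply/forallP => i; rewrite (eqP (all_d i)).
  congr (nat_of_bool _)%:R; apply: eq_forallb => i.
  by rewrite eqn_leq led /= subn_eq0.
rewrite map_rcons /sweep foldr_rcons -/(sweep _ _).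
have -> : commutator (chi a) (suffix_top_cell e) =
    fun u => \sum_i (a i)%:R * suffix_top_cell (fun j => (e j + (j == i))%N) u.
  by apply/funext => u; rewrite commutator_chi; apply: eq_bigr => i _; rewrite commutator_sign_suffix_top_cell.
have -> : rho (sweep (map chi chars)
     (fun u => \sum_i (a i)%:R * suffix_top_cell (fun j => (e j + (j == i))%N) u)) =
   \sum_i (a i)%:R * rho (sweep (map chi chars) (suffix_top_cell (fun j => (e j + (j == i))%N))).
  rewrite /rho; under [RHS]eq_bigr do rewrite mulr_sumr.
  rewrite [RHS]exchange_big /=; apply: eq_bigr => u _.
  by rewrite sweep_sum; apply: eq_bigr => i _; rewrite sweepZ.
rewrite -cats1 big_cat big_seq1 /linear_form /= mulr_sumr mcoef_sum.
case: forallP => [led|nle]; last first.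
  rewrite big1 // => i _; rewrite IH; case: forallP => [all_d|_]; last by rewrite mulr0.
  by case: nle => j; apply: leq_trans (all_d j); rewrite leq_addr.
apply: eq_bigr => i _; rewrite IH; case: (a i); last by rewrite mul0r mulr0 mcoef0.
rewrite mul1r mcoefM_var //; case: (posnP (d - e i)%N) => [de|].
  rewrite de; case: forallP => // /(_ i); rewrite eqxx addn1.
  by move/eqP: de; rewrite subn_eq0; move=> de lt; have := leq_trans lt de; rewrite ltnn.
case E: (d - e i)%N => [//|m] _; rewrite ifT; last first.
  apply/forallP => j; rewrite (inj_eq val_inj); have [->|_] := eqVneq j i.
    by rewrite addn1 -subn_gt0 E.
  by rewrite addn0.
by apply: eq_mcoef => j _; rewrite subnDA.
Qed.

Lemma sweep_delta ss h u : sweep ss h u =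
  \sum_v h v * sweep ss (fun w => (w == v)%:R) u.
Proof.
transitivity (sweep ss (fun w => \sum_v h v * (w == v)%:R) u).
  congr (sweep _ _ u); apply/funext => w; rewrite (bigD1 w) //= eqxx mulr1.
  by rewrite big1 ?addr0 // => v /negPf; rewrite eq_sym => ->; rewrite mulr0.
by rewrite sweep_sum; apply: eq_bigr => v _; rewrite sweepZ.
Qed.

(** The sign sg j u stands for the constant sign of the j-th function on the cell
    u, if there is one. If every top cell had a sign for some j, then along a
    chain that ends in a cell with sign j this sign would be the same on all
    faces, so that it could not change at the step for j, and the sweep would
    be zero. But [rho] sends it to the given coefficient, by [rho_sweep_swap] and
    [rho_sweep_chi]. *)
Theorem signless_cell (J : eqType) (L : seq J) (a : J -> sign_group)
    (sg : J -> cell -> option bool) :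
  (forall j u p x b, up (entry u p) x -> sg j (upd u p x) = Some b -> sg j u = Some b) ->
  (forall j g u, sg j (flip g u) = omap (addb (dot (a j) g)) (sg j u)) ->
  mcoef (\prod_(j <- L) linear_form (a j)) (fun=> d) != 0 ->
  exists2 u, on_sphere u & forall j, j \in L -> sg j u = None.
Proof.
move=> sg_face sg_flip.
pose S j u : 'F_2 := if sg j u is Some b then b%:R else chi (a j) u.
have Sa j : equivariant (a j) (S j).
  move=> g u vu; rewrite /S sg_flip; case: (sg j u) => [b|] /=.
    by rewrite addbC F2_natb_add.
  exact: equivariant_chi.
rewrite -(big_map a xpredT (fun b => linear_form b)).
have := rho_sweep_chi (map a L) (fun=> 0%N).
rewrite ifT; last exact/forallP.
rewrite (@eq_mcoef _ _ _ (fun=> d)) => [<-|i _]; last by rewrite subn0.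
rewrite -map_comp -(rho_sweep_swap (a := a) L Sa) /comp; first last.
- exact: cofaces_suffix_top_cell0.
- exact: invariant_suffix_top_cell.
- exact: supported_suffix_top_cell.
- by move=> j; exact: equivariant_chi.
move=> rho_neq0.
case: (pickP [pred u | on_sphere u & all (fun j => sg j u == None) L]) => [u /andP[vu /allP all_u]|none].
  by exists u => // j /all_u /eqP.
case/eqP: rho_neq0; rewrite /rho big1 // => u _; rewrite sweep_delta big1 // => v _.
case vv: (on_sphere v); last by rewrite supported_suffix_top_cell ?vv // mul0r.
have /negbT := none v; rewrite /= vv /= -has_predC => /hasP[j jL /= sgj].
suff -> : sweep (map S L) (fun w => (w == v)%:R) = fun=> 0 by rewrite mulr0.
(* functions supported on cells with sign j; these cells are closed under
   faces *)
pose closed (h : cell -> 'F_2) := forall w, sg j w = None -> h w = 0.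
have closed_sweep ss h : closed h -> closed (sweep ss h).
  elim: ss => //= s ss IH /IH hc w wN; rewrite commutatorE big1 // => p _.
  rewrite big1 // => x ux; case sv: (sg j (upd w p x)) => [b|].
    by have := sg_face _ _ _ _ _ ux sv; rewrite wN.
  by rewrite hc ?mulr0.
case/splitPr: jL => L1 L2; rewrite map_cat /sweep foldr_cat /= -!/(sweep _ _).
have : closed (sweep (map S L2) (fun w => (w == v)%:R)).
  apply: closed_sweep => w wN; case: eqP => // wv.
  by move: sgj; rewrite -wv wN eqxx.
move: (sweep _ _) => h hc.
suff -> : commutator (S j) h = fun=> 0 by exact: sweep0.
apply/funext => w; rewrite commutatorE big1 // => p _; rewrite big1 // => x ux.
case sv: (sg j (upd w p x)) => [b|]; last by rewrite hc ?mulr0.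
by rewrite /S sv (sg_face _ _ _ _ _ ux sv) F2_addrr mul0r.
Qed.
End Grid.

(** * Powers of linearized polynomials in characteristic 2 *)

Section Linearized.
Local Open Scope ring_scope.
Variable A : comNzRingType.
Hypothesis char2 : forall x : A, x + x = 0.

Lemma poly_char2 (p : {poly A}) : p + p = 0.
Proof. by apply/polyP => i; rewrite coefD char2 coef0. Qed.

Lemma char2_exprD (B : comNzRingType) (B2 : forall x : B, x + x = 0) (x y : B) t :
  (x + y) ^+ (2 ^ t) = x ^+ (2 ^ t) + y ^+ (2 ^ t).
Proof.
elim: t => [|t IH]; first by rewrite !expr1.
by rewrite expnSr !exprM IH sqrrD mulr2n B2 addr0.
Qed.

Lemma char2_expr_sum (B : comNzRingType) (B2 : forall x : B, x + x = 0)
    (I : Type) (r : seq I) (F : I -> B) t :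
  (\sum_(i <- r) F i) ^+ (2 ^ t) = \sum_(i <- r) F i ^+ (2 ^ t).
Proof.
apply: (big_morph (fun x => x ^+ (2 ^ t))) => [x y|]; first exact: char2_exprD.
by rewrite expr0n expn_eq0.
Qed.

Lemma coef_sqr (r : {poly A}) i :
  (r ^+ 2)`_i = if odd i then 0 else r`_(i./2) ^+ 2.
Proof.
rewrite -[r in LHS]coefK poly_def (char2_expr_sum poly_char2 _ _ 1) coef_sum.
have E (j : 'I_(size r)) : ((r`_j *: 'X^j) ^+ (2 ^ 1))`_i =
    if i == (2 * j)%N then r`_j ^+ 2 else 0.
  by rewrite exprZn -exprM coefZ coefXn mulnC; case: eqP; rewrite ?mulr1 ?mulr0.
under eq_bigr do rewrite E.
case: ifP => oi; first by rewrite big1 // => j _; rewrite ifF //; lia.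
have [lt|ge] := ltnP i./2 (size r).
  rewrite (bigD1 (Ordinal lt)) //= ifT; last by lia.
  rewrite big1 ?addr0 // => j; rewrite -(inj_eq val_inj) /= => jn.
  by rewrite ifF //; lia.
rewrite nth_default // expr0n big1 // => j _; rewrite ifF //.
by have := ltn_ord j; lia.
Qed.

(** In characteristic 2, the shape of the polynomials that are additive. *)
Definition linearized n (p : {poly A}) :=
  exists2 c : nat -> A, c n = 1 & p = \sum_(j < n.+1) c j *: 'X^(2 ^ j).

Lemma linearized_coef n p i : linearized n p -> (forall j, i != 2 ^ j)%N -> p`_i = 0.
Proof.
move=> [c _ ->] ni; rewrite coef_sum big1 // => j _.
by rewrite coefZ coefXn (negPf (ni j)) mulr0.
Qed.

(** By induction on t through the binary digits of q: p^(q/2) squared has only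
    even exponents, and the only odd exponent in p is 1. *)
Lemma coef_linearized_expr_gap n p t q s : linearized n p -> (q < 2 ^ t)%N ->
  (p ^+ q)`_(q + 2 ^ t * s.+1) = 0.
Proof.
move=> lp; elim: t q s => [|t IH] q s qt.
  by rewrite expn0 ltnS leqn0 in qt; rewrite (eqP qt) expr0 coef1 add0n mul1n.
have q't : (q./2 < 2 ^ t)%N by move: qt; rewrite expnS; lia.
have sq0 i : i = (2 * (q./2 + 2 ^ t * s.+1))%N -> ((p ^+ q./2) ^+ 2)`_i = 0.
  move=> ->; rewrite coef_sqr mul2n odd_double doubleK IH // expr0n //.
have -> : p ^+ q = p ^+ odd q * (p ^+ q./2) ^+ 2.
  by rewrite -{1}(odd_double_half q) -mul2n mulnC exprD exprM.
case: (boolP (odd q)) => oq; last first.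
  by rewrite expr0 mul1r; apply: sq0; rewrite expnS; lia.
rewrite expr1 coefM big1 // => j _.
have [oj|ej] := boolP (odd j).
  have [j1|j1] := eqVneq (j : nat) 1%N.
    by rewrite sq0 ?mulr0 // j1 expnS; lia.
  rewrite (linearized_coef lp) ?mul0r // => -[|i]; first by rewrite expn0.
  by apply: contraTneq oj => ->; rewrite expnS oddM.
rewrite coef_sqr ifT ?mulr0 //; have := ltn_ord j.
rewrite ltnS => jle; rewrite oddB // (negPf ej) addbF.
by rewrite oddD oq expnS -mulnA oddM.
Qed.

Lemma coef_linearized_expr_diag n p q : linearized n p -> (p ^+ q)`_q = p`_1 ^+ q.
Proof.
move=> lp; elim: q => [|q IH]; first by rewrite !expr0 coef1.
have p0 : p`_0 = 0 by apply: (linearized_coef lp) => j; rewrite eq_sym expn_eq0.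
have low i : (i < q)%N -> (p ^+ q)`_i = 0.
  elim: q i {IH} => // q IH i iq; rewrite exprS coefM big1 // => -[[|j] ji] _ /=.
    by rewrite p0 mul0r.
  by rewrite IH ?mulr0 //; lia.
rewrite exprS coefM (bigD1 (inord 1)) //= inordK // subn1 /= IH big1 ?addr0 ?exprS //.
move=> -[[|[|j]] ji] //=; rewrite ?p0 ?mul0r // -?(inj_eq val_inj) /= ?inordK //.
by rewrite low ?mulr0 //; lia.
Qed.

(** Expand p^(2^t) as the sum of the c_j^(2^t) X^(2^(j+t)). The term for j = n
    leaves the lowest coefficient of p^q; for j < n the exponent left for p^q
    is q plus a positive multiple of 2^t, and the coefficient vanishes by
    [coef_linearized_expr_gap]. *)
Lemma coef_linearized_expr n p t q : linearized n p -> (q < 2 ^ t)%N ->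
  (p ^+ (2 ^ t + q))`_(2 ^ (n + t) + q) = p`_1 ^+ q.
Proof.
move=> lp qt; have [c cn pE] := lp.
have -> : p ^+ (2 ^ t + q) = \sum_(j < n.+1) c j ^+ (2 ^ t) *: ('X^(2 ^ (j + t)) * p ^+ q).
  rewrite exprD {1}pE (char2_expr_sum poly_char2) mulr_suml; apply: eq_bigr => j _.
  by rewrite exprZn -exprM -expnD scalerAl.
rewrite coef_sum big_ord_recr /= cn expr1n scale1r coefXnM ltnNge leq_addr /=.
rewrite addKn (coef_linearized_expr_diag _ lp) big1 ?add0r // => j _.
have le : (2 ^ (j + t) * 2 <= 2 ^ (n + t))%N.
  by rewrite -expnSr leq_exp2l // ltn_add2r.
rewrite coefZ coefXnM ifF; last by lia.
have -> : (2 ^ (n + t) + q - 2 ^ (j + t) = q + 2 ^ t * (2 ^ n - 2 ^ j).-1.+1)%N.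
  rewrite prednK; last by rewrite subn_gt0 ltn_exp2l.
  by rewrite mulnBr -!expnD ![(t + _)%N]addnC; lia.
by rewrite (coef_linearized_expr_gap _ lp) // mulr0.
Qed.

Lemma linearized_comp n p x : linearized n p ->
  p \Po ('X + x%:P) = p + (p.[x])%:P.
Proof.
move=> [c _ ->]; rewrite raddf_sum /= horner_sum raddf_sum -big_split /=.
apply: eq_bigr => j _; rewrite comp_polyZ comp_Xn_poly (char2_exprD poly_char2).
by rewrite hornerZ hornerXn scalerDr polyCM -mul_polyC -[X in _ + X]mul_polyC polyC_exp mul_polyC.
Qed.

(** For p the product of X + v over a space V, the product over V + F_2 x is
    p(X) p(X + x) = p(X) (p(X) + p(x)), because p is additive. *)
Lemma linearized_step n p x : linearized n p ->
  linearized n.+1 (p * (p \Po ('X + x%:P))).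
Proof.
move=> lp; rewrite (linearized_comp _ lp); case: lp => c cn pE.
exists (fun j => if j is i.+1 then c i ^+ 2 + (if (i < n)%N then p.[x] * c i.+1 else 0)
                 else p.[x] * c 0%N); first by rewrite cn expr1n ltnn addr0.
rewrite mulrDr -expr2 {1}pE (char2_expr_sum poly_char2 _ _ 1) [RHS]big_ord_recl /=.
have -> : p * p.[x]%:P = p.[x] *: p by rewrite mulrC mul_polyC.
rewrite {2}pE scaler_sumr [X in _ + X = _]big_ord_recl /=.
rewrite addrCA scalerA; congr (_ + _).
under [RHS]eq_bigr do rewrite scalerDl.
rewrite big_split /=; congr (_ + _).
  by apply: eq_bigr => j _; rewrite exprZn -exprM -expnSr.
rewrite [RHS]big_ord_recr /= ltnn scale0r addr0; apply: eq_bigr => j _.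
by rewrite ltn_ord scalerA.
Qed.

End Linearized.

(** * Monomials of powers of the product of all linear forms *)

Section Dickson.
Local Open Scope ring_scope.

Definition ffun_rcons n (a : {ffun 'I_n -> bool}) (b : bool) : {ffun 'I_n.+1 -> bool} :=
  [ffun i => if unlift ord_max i is Some j then a j else b].

Lemma ffun_rcons_max n (a : {ffun 'I_n -> bool}) b : ffun_rcons a b ord_max = b.
Proof. by rewrite ffunE unlift_none. Qed.

Lemma ffun_rcons_widen n (a : {ffun 'I_n -> bool}) b i :
  ffun_rcons a b (widen_ord (leqnSn n) i) = a i.
Proof.
rewrite ffunE (_ : widen_ord _ i = lift ord_max i) ?liftK //.
by apply/val_inj; rewrite /= /bump leqNgt ltn_ord.
Qed.

Lemma prod_ffun_rcons (B : comNzRingType) n (F : {ffun 'I_n.+1 -> bool} -> B) :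
  \prod_a F a = \prod_a (F (ffun_rcons a false) * F (ffun_rcons a true)).
Proof.
rewrite big_split /= mulrC.
transitivity (\prod_(ba : bool * {ffun 'I_n -> bool}) F (ffun_rcons ba.2 ba.1)).
  pose f (ba : bool * {ffun 'I_n -> bool}) := ffun_rcons ba.2 ba.1.
  pose g (a : {ffun 'I_n.+1 -> bool}) := (a ord_max, [ffun i => a (lift ord_max i)]).
  apply: (reindex f); apply: onW_bij; exists g => [[b a]|a].
    rewrite /f /g ffun_rcons_max; congr pair; apply/ffunP => i.
    by rewrite !ffunE liftK.
  apply/ffunP => i; rewrite !ffunE; case: unliftP => [j ->|->] //=.
  by rewrite ffunE.
by rewrite -(pair_bigA _ (fun b a => F (ffun_rcons a b))) /= big_bool.
Qed.

Lemma linearized_subspace (A : comNzRingType) (y : nat -> A) n :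
  (forall x : A, x + x = 0) ->
  linearized n (\prod_(a : {ffun 'I_n -> bool})
     ('X + (\sum_(i < n) if a i then y i else 0)%:P)).
Proof.
move=> char2; elim: n => [|n IH].
  exists (fun=> 1) => //; rewrite big_ord1 expr1 scale1r.
  rewrite (bigD1 [ffun=> false]) //= big_ord0 addr0 big1 ?mulr1 // => a.
  by case/eqP; apply/ffunP; case.
have := linearized_step char2 (y n) IH; congr linearized.
rewrite prod_ffun_rcons rmorph_prod -big_split /=; apply: eq_bigr => a _.
rewrite comp_polyD comp_polyX comp_polyC !big_ord_recr /= !ffun_rcons_max addr0.
have E b : \sum_(i < n) (if ffun_rcons a b (widen_ord (leqnSn n) i) then y i else 0)
  = \sum_(i < n) (if a i then y i else 0).
  by apply: eq_bigr => i _; rewrite ffun_rcons_widen.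
by rewrite !E polyCD addrAC addrA.
Qed.

Lemma tower_char2 n (x : tower n) : x + x = 0.
Proof.
by elim: n x => [|n IH] x; [exact: F2_addrr | exact: poly_char2].
Qed.

Definition dickson n : tower n :=
  \prod_(a : {ffun 'I_n -> bool} | a != [ffun=> false]) linear_form a.

Lemma linear_form_rcons n (a : {ffun 'I_n -> bool}) b :
  linear_form (ffun_rcons a b) =
  (if b then 'X else 0) + (linear_form a)%:P :> {poly tower n}.
Proof.
rewrite /linear_form big_ord_recr /= ffun_rcons_max eqxx addrC; congr (_ + _).
rewrite rmorph_sum /=; apply: eq_bigr => i _; rewrite ffun_rcons_widen.
by rewrite ltn_eqF //; case: (a i).
Qed.

(** In F_2[x_0, ..., x_(n-1)][X], the forms in n + 1 variables that involve the
    last one, which is X. *)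
Definition subspace_poly n : {poly tower n} :=
  \prod_(a : {ffun 'I_n -> bool}) ('X + (linear_form a)%:P).

Lemma dicksonS n : dickson n.+1 = (dickson n)%:P * subspace_poly n :> {poly tower n}.
Proof.
rewrite /dickson big_mkcond prod_ffun_rcons big_split /=; congr (_ * _); last first.
  apply: eq_bigr => a _; rewrite linear_form_rcons ifT //.
  by apply/eqP => /ffunP/(_ ord_max); rewrite ffun_rcons_max ffunE.
rewrite rmorph_prod [RHS]big_mkcond /=; apply: eq_bigr => a _.
rewrite linear_form_rcons add0r; congr (if _ then _ else _); congr negb.
apply/eqP/eqP => [/ffunP e|->]; apply/ffunP => i; rewrite ffunE.
  by move: (e (widen_ord (leqnSn n) i)); rewrite ffun_rcons_widen ffunE.
by rewrite ffunE; case: unlift => // j; rewrite ffunE.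
Qed.

Lemma linear_form0 n : linear_form ([ffun=> false] : {ffun 'I_n -> bool}) = 0.
Proof. by rewrite /linear_form big1 // => i _; rewrite ffunE. Qed.

Lemma subspace_poly_coef1 n : (subspace_poly n)`_1 = dickson n.
Proof.
rewrite /subspace_poly (bigD1 [ffun=> false]) //= linear_form0 addr0 coefXM /=.
rewrite /dickson -horner_coef0 horner_prod; apply: eq_bigr => a _.
by rewrite hornerD hornerX hornerC add0r.
Qed.

(** Induction on k. The coefficient of X^(2^(n+p) + q) in the power of
    [dickson n.+1] is [dickson n] to the power 2^p + 2q, by
    [coef_linearized_expr]. If 2q < 2^p the induction hypothesis applies to
    (p, 2q), otherwise to (p + 1, 2q - 2^p); in both cases its bound on the
    exponents is at most 2^(n+p) + q. *)
Theorem dickson_expr_monomial k p q : (q < 2 ^ p)%N ->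
  exists2 e : nat -> nat, (forall i, (i < k)%N -> (e i <= 2 ^ (k + p - 1) + q)%N) &
    mcoef (dickson k ^+ (2 ^ p + q)) e != 0.
Proof.
elim: k p q => [|n IH] p q qp.
  exists (fun=> 0%N) => //; rewrite /dickson big1 ?expr1n //=.
  by move=> a /eqP[]; apply/ffunP; case.
have lin : linearized n (subspace_poly n).
  exact: (linearized_subspace (tvar n) n (@tower_char2 n)).
have [e ele en0] : exists2 e : nat -> nat,
    (forall i, (i < n)%N -> (e i <= 2 ^ (n + p) + q)%N) &
    mcoef (dickson n ^+ (2 ^ p + (q + q))) e != 0.
  have [lt|ge] := ltnP (q + q) (2 ^ p).
    have [e ele en0] := IH p (q + q)%N lt; exists e => // i lin_.
    apply: leq_trans (ele i lin_) _; rewrite addnA leq_add2r.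
    have n0 : (0 < n)%N by lia.
    have -> : (n + p = (n + p - 1).+1)%N by lia.
    rewrite expnS mul2n -addnn; rewrite subSS subn0 leq_add2l ltnW //.
    by apply: leq_trans qp _; rewrite leq_exp2l //; lia.
  have lt : (q + q - 2 ^ p < 2 ^ p.+1)%N by rewrite expnS; lia.
  have [e ele en0] := IH p.+1 _ lt; exists e.
    move=> i lin_; apply: leq_trans (ele i lin_) _.
    have -> : (n + p.+1 - 1 = n + p)%N by lia.
    by lia.
  by move: en0; congr (mcoef (_ ^+ _) _ != 0); rewrite expnS; lia.
exists (fun i => if i == n then (2 ^ (n + p) + q)%N else e i) => [i|].
  rewrite ltnS leq_eqVlt addSn subSS subn0; case: eqP => //= _; exact: ele.
rewrite /= eqxx dicksonS exprMn -polyC_exp coefCM.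
rewrite (coef_linearized_expr (@tower_char2 n) lin qp) subspace_poly_coef1 -exprD.
rewrite -addnA; move: en0; congr (_ != 0); apply: eq_mcoef => i lt.
by rewrite ltn_eqF.
Qed.

End Dickson.

(** * Common zeros of equivariant functions *)

Section BorsukUlam.
Local Open Scope classical_set_scope.
Local Open Scope ring_scope.
Variables (R : realType) (k d : nat).

Definition flip_rows (g : {ffun 'I_k -> bool}) (x : 'M[R]_(k, d.+1)) :=
  \matrix_(i, c) (if g i then - x i c else x i c).

Section Cells.
Variable n : nat.
Hypothesis n_gt0 : (0 < n)%N.
Implicit Types (u : cell k d n) (x : 'M[R]_(k, d.+1)).

Definition pt (a : coord n) : R := (a%:R - (2 * n)%:R).

(** The sphere is the boundary of the cube [-1, 1]^(d+1), the grid has step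
    1 / 2n. *)
Definition closed_cell u : set 'M[R]_(k, d.+1) :=
  [set x | forall i c, `|(2 * n)%:R * x i c - pt (u i c)| <= (odd (u i c))%:R].

Definition center u : 'M[R]_(k, d.+1) := \matrix_(i, c) (pt (u i c) / (2 * n)%:R).

Lemma two_n_gt0 : 0 < (2 * n)%:R :> R.
Proof. by rewrite ltr0n muln_gt0. Qed.

Lemma center_closed_cell u : closed_cell u (center u).
Proof.
move=> i c; rewrite mxE mulrC divfK ?gt_eqF ?two_n_gt0 // subrr normr0.
exact: ler0n.
Qed.

Lemma closed_cell_face u p (b : coord n) : up (entry u p) b ->
  closed_cell u `<=` closed_cell (upd u p b).
Proof.
move=> /and3P[ev ox /orP adj] y uy i c; rewrite -[upd u p b i c]/(entry (upd u p b) (i, c)).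
rewrite entry_upd; case: eqP => [ic|_]; last exact: uy.
have := uy i c; rewrite -[u i c]/(entry u (i, c)) ic (negPf ev) normr_le0 subr_eq0 ox.
move=> /eqP ->; rewrite /pt opprB addrA subrK.
case: adj => /eqP ->; rewrite -natr1; last by rewrite addrC addKr normr1.
by rewrite opprD addrA subrr add0r normrN normr1.
Qed.

Lemma pt_flipb b a : pt (flipb b a) = if b then - pt a else pt a.
Proof.
case: b => //; rewrite /pt /= subSS opprB natrB; last by rewrite -ltnS.
by rewrite -[X in X%:R - _ - _](_ : 2 * n + 2 * n = _)%N ?natrD; [ring|lia].
Qed.

Lemma closed_cell_flip g u x :
  closed_cell (flip g u) x <-> closed_cell u (flip_rows g x).
Proof.
suff E i c : `|(2 * n)%:R * x i c - pt (flip g u i c)| =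
    `|(2 * n)%:R * flip_rows g x i c - pt (u i c)|.
  by split => H i c; have := H i c; rewrite -?E ?E !ffunE odd_flipb.
rewrite !ffunE mxE pt_flipb; case: (g i) => //.
by rewrite -normrN opprB mulrN addrC.
Qed.

Lemma center_bounded u i c : `|center u i c| <= 1.
Proof.
rewrite mxE normrM normfV [`|_%:R|]gtr0_norm ?two_n_gt0 // ler_pdivrMr ?two_n_gt0 //.
rewrite mul1r ler_norml /pt; have := ltn_ord (u i c); rewrite ltnS.
have : 0 <= (u i c)%:R :> R by exact: ler0n.
rewrite -(ler_nat R) !natrM; lra.
Qed.

Lemma center_extremal u i c : extremal (u i c) -> `|center u i c| = 1.
Proof.
move=> ex; rewrite mxE normrM normfV [`|_%:R|]gtr0_norm ?two_n_gt0 //.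
suff -> : `|pt (u i c)| = (2 * n)%:R by rewrite divff // gt_eqF ?two_n_gt0.
case/orP: ex => /eqP ex; rewrite /pt ex.
  by rewrite sub0r normrN gtr0_norm ?two_n_gt0.
by rewrite -natrB ?leq_mul2r ?orbT // -mulnBl gtr0_norm ?two_n_gt0.
Qed.

Lemma closed_cell_near u x i c : closed_cell u x ->
  `|center u i c - x i c| <= (2 * n)%:R^-1.
Proof.
move=> /(_ i c) ux; rewrite mxE -[x i c](mulKf (lt0r_neq0 two_n_gt0)) mulrC -mulrBr.
rewrite normrM normfV [`|_%:R|]gtr0_norm ?two_n_gt0 // distrC.
rewrite ger_pMr ?invr_gt0 ?two_n_gt0 //; apply: le_trans ux _.
by case: (odd _).
Qed.

(** If no such cell existed, each top cell would carry a constant strict sign of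
    some f_j, which is what [signless_cell] excludes; strict signs on a closed
    cell pass to its faces. *)
Lemma changing_cell (J : eqType) (L : seq J) (a : J -> {ffun 'I_k -> bool})
    (f : J -> 'M[R]_(k, d.+1) -> R) :
  (forall j g x, f j (flip_rows g x) = (-1) ^+ dot (a j) g * f j x) ->
  mcoef (\prod_(j <- L) linear_form (a j)) (fun=> d) != 0 ->
  exists2 u : cell k d n, on_sphere u & forall j, j \in L ->
    (exists2 x, closed_cell u x & f j x <= 0) /\
    (exists2 x, closed_cell u x & 0 <= f j x).
Proof.
move=> f_flip coef.
pose pos j u := `[< forall x, closed_cell u x -> 0 < f j x >].
pose neg j u := `[< forall x, closed_cell u x -> f j x < 0 >].
have pos_neg j u : pos j u -> neg j u -> False.
  move=> /asboolP/(_ _ (center_closed_cell u)) + /asboolP/(_ _ (center_closed_cell u)).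
  by move=> /lt_trans /[apply]; rewrite ltxx.
pose sg j u := if pos j u then Some false else if neg j u then Some true else None.
have flipE j g u : (pos j (flip g u) = if dot (a j) g then neg j u else pos j u) /\
    (neg j (flip g u) = if dot (a j) g then pos j u else neg j u).
  have flip_rowsK x : flip_rows g (flip_rows g x) = x.
    by apply/matrixP => i c; rewrite !mxE; case: (g i); rewrite ?opprK.
  have E (P : R -> Prop) : (forall x, closed_cell (flip g u) x -> P (f j x)) <->
      (forall x, closed_cell u x -> P ((-1) ^+ dot (a j) g * f j x)).
    split => H x ux; first by rewrite -f_flip; apply: H; rewrite closed_cell_flip flip_rowsK.
    by rewrite -[x]flip_rowsK f_flip; apply: H; exact/closed_cell_flip.
  split; case: (dot _ _) E => E.
  - apply/asboolP/asboolP => [/(E (fun y => 0 < y)) H x /H|H].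
      by rewrite expr1 mulN1r oppr_gt0.
    by apply/(E (fun y => 0 < y)) => x /H; rewrite expr1 mulN1r oppr_gt0.
  - apply/asboolP/asboolP => [/(E (fun y => 0 < y)) H x /H|H].
      by rewrite expr0 mul1r.
    by apply/(E (fun y => 0 < y)) => x /H; rewrite expr0 mul1r.
  - apply/asboolP/asboolP => [/(E (fun y => y < 0)) H x /H|H].
      by rewrite expr1 mulN1r oppr_lt0.
    by apply/(E (fun y => y < 0)) => x /H; rewrite expr1 mulN1r oppr_lt0.
  - apply/asboolP/asboolP => [/(E (fun y => y < 0)) H x /H|H].
      by rewrite expr0 mul1r.
    by apply/(E (fun y => y < 0)) => x /H; rewrite expr0 mul1r.
have [||u vu sgu] := @signless_cell k d n n_gt0 J L a sg _ _ coef.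
- move=> j u p x b ux; have sub := closed_cell_face ux.
  rewrite /sg; case: ifP => [/asboolP pv [<-]|_].
    by rewrite ifT //; apply/asboolP => y /sub /pv.
  case: ifP => [/asboolP nv [<-]|//].
  have nu : neg j u by apply/asboolP => y /sub /nv.
  by rewrite nu ifF //; apply/negP => pu; exact: pos_neg pu nu.
- move=> j g u; rewrite /sg; have [-> ->] := flipE j g u; case: (dot _ _) => /=.
    case Ep: (pos j u); case En: (neg j u) => //.
    by have := pos_neg _ _ Ep En.
  by case: (pos j u); case: (neg j u).
exists u => // j /sgu; rewrite /sg.
case: ifP => // /asboolP/existsNP[x /not_implyP[ux /negP fx]].
case: ifP => // /asboolP/existsNP[y /not_implyP[uy /negP fy]] _.
by split; [exists x; rewrite // leNgt | exists y; rewrite // leNgt].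
Qed.

End Cells.

(** A limit point of the cells of [changing_cell], for finer and finer grids,
    is a common zero. The centres stay in the cube, and each row of a centre
    has an entry of absolute value 1, so the rows of the limit are nonzero. *)
Theorem equivariant_common_zero (J : eqType) (L : seq J)
    (a : J -> {ffun 'I_k -> bool}) (f : J -> 'M[R]_(k, d.+1) -> R) :
  (forall j, continuous (f j)) ->
  (forall j g x, f j (flip_rows g x) = (-1) ^+ dot (a j) g * f j x) ->
  mcoef (\prod_(j <- L) linear_form (a j)) (fun=> d) != 0 ->
  exists2 x : 'M[R]_(k, d.+1), (forall i, exists c, x i c != 0) &
    forall j, j \in L -> f j x = 0.
Proof.
move=> f_cont f_flip coef.
have ex n : {u : cell k d n.+1 | on_sphere u & forall j, j \in L ->
    (exists2 x, closed_cell u x & f j x <= 0) /\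
    (exists2 x, closed_cell u x & 0 <= f j x)}.
  by apply: cid2; exact: changing_cell.
pose u n := s2val (ex n).
pose v (n : nat) : 'rV[R]_(k * d.+1) := mxvec (center (u n)).
have v_compact : compact [set w : 'rV[R]_(k * d.+1) | forall i, `[(-1 : R), 1]%classic (w 0 i)].
  apply: (@rV_compact _ _ (fun=> `[(-1 : R), 1]%classic)) => _.
  exact: segment_compact.
have [|w [_ wcl]] := v_compact (v @ \oo) _.
  exists 0%N => // n _ /= i; case/mxvec_indexP: i => i c; rewrite mxvecE /= in_itv /=.
  by rewrite -ler_norml center_bounded.
pose x : 'M[R]_(k, d.+1) := vec_mx w.
have near_x (e : R) (N : nat) : 0 < e ->
    exists2 n, (N <= n)%N & ball x e (center (u n)).
  move=> e0; have [|_ [[n Nn <-] wn]] := wcl (v @` [set n | (N <= n)%N]) (ball w e) _ (nbhsx_ballx _ _ e0).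
    exists N => // n /= Nn; by exists n.
  exists n => //; split => // i c; have := wn.2 0 (mxvec_index i c).
  by rewrite mxvecE -{1}[w]vec_mxK mxvecE.
exists x => [i|j jL].
  have [n _ xn] := near_x 1 0%N ltr01.
  have /existsP[c ec] := forallP (s2valP (ex n)) i.
  exists c; apply/eqP => xc; have := xn.2 i c.
  by rewrite -ball_normE /= xc sub0r normrN center_extremal // ltxx.
have near_cell (e : R) : 0 < e -> exists n, forall y, closed_cell (u n) y -> ball x e y.
  move=> e0; have e20 : 0 < e / 2 by rewrite divr_gt0.
  have [N Ne] : exists N : nat, (2 * N.+1)%:R^-1 < e / 2.
    exists (Num.truncn e^-1); rewrite invf_plt ?posrE ?two_n_gt0 // invf_div natrM.
    rewrite ltr_pM2l ?ltr0n //.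
    by rewrite truncnS_gt.
  have [n Nn xn] := near_x _ N e20; exists n => y uy; split => // i c.
  rewrite -ball_normE /= (splitr e).
  apply: le_lt_trans (ler_distD (center (u n) i c) _ _) _.
  apply: ltrD; first by have := xn.2 i c; rewrite -ball_normE.
  apply: le_lt_trans (closed_cell_near _ _ _ uy) _ => //.
  apply: le_lt_trans Ne; rewrite lef_pV2 ?posrE ?two_n_gt0 // ler_nat.
  by rewrite leq_mul2l ltnS.
apply/eqP; rewrite eq_le; apply/andP; split; rewrite leNgt; apply/negP => fx.
  have /nbhs_ballP[e /= e0 be] : \forall y \near x, 0 < f j y.
    exact: (cvgr_gt _ (f_cont j x)).
  have [n un] := near_cell e e0.
  have [[y uy]] := (s2valP' (ex n) j jL).1; rewrite leNgt => /negP; apply.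
  by apply: be; exact: un.
have /nbhs_ballP[e /= e0 be] : \forall y \near x, f j y < 0.
  exact: (cvgr_lt _ (f_cont j x)).
have [n un] := near_cell e e0.
have [[y uy]] := (s2valP' (ex n) j jL).2; rewrite leNgt => /negP; apply.
by apply: be; exact: un.
Qed.

End BorsukUlam.

(** * Characters of the group of sign vectors *)

Section Characters.
Local Open Scope ring_scope.
Variable k : nat.
Implicit Types a g h : sign_group k.

Definition addg g h : sign_group k := [ffun i => g i (+) h i].

Lemma addgK h : involutive (addg^~ h).
Proof. by move=> g; apply/ffunP => i; rewrite !ffunE addbK. Qed.

Lemma dot_addg a g h : dot a (addg g h) = dot a g (+) dot a h.
Proof.
by rewrite /dot -big_split; apply: eq_bigr => i _; rewrite ffunE; case: (a i).
Qed.

Lemma sum_sign_dot (R : numDomainType) g :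
  \sum_(a : sign_group k) (-1) ^+ dot a g = if g == [ffun=> false] then 2 ^+ k else 0 :> R.
Proof.
transitivity (\prod_(i < k) \sum_(b : bool) (-1) ^+ (b && g i) : R).
  rewrite bigA_distr_bigA /=; apply: eq_bigr => a _.
  exact: (big_morph _ (@signr_addb R) (erefl _)).
case: eqP => [->|g0].
  under eq_bigr do rewrite big_bool ffunE /= -mulr2n.
  by rewrite prodr_const card_ord.
have [i gi] : exists i, g i.
  apply/existsP; apply: contra_notT g0 => /existsPn no; apply/ffunP => i.
  by rewrite ffunE; exact: negPf (no i).
by rewrite (bigD1 i) //= big_bool gi /= expr1 expr0 addNr mul0r.
Qed.

(** Fourier inversion: only the trivial character contributes, and it takes the
    same value everywhere. *)
Lemma constant_of_char_sums (R : numDomainType) (F : sign_group k -> R) :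
  (forall a, a != [ffun=> false] -> \sum_g (-1) ^+ dot a g * F g = 0) ->
  forall g g', F g = F g'.
Proof.
move=> F0.
suff E g : 2 ^+ k * F g = \sum_h (-1) ^+ dot [ffun=> false] h * F h.
  by move=> g g'; apply: (@mulfI _ (2 ^+ k)); rewrite ?expf_neq0 ?pnatr_eq0 // !E.
transitivity (\sum_a (-1) ^+ dot a g * \sum_h (-1) ^+ dot a h * F h).
  under eq_bigr do rewrite mulr_sumr.
  rewrite exchange_big /=.
  transitivity (\sum_h F h * \sum_a (-1) ^+ dot a (addg g h)).
    rewrite (bigD1 g) //= [X in _ + X]big1 ?addr0.
      have -> : addg g g = [ffun=> false] by apply/ffunP => i; rewrite !ffunE addbb.
      by rewrite sum_sign_dot eqxx mulrC.
    move=> h hg; rewrite sum_sign_dot ifF ?mulr0 //.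
    apply: contraNF hg => /eqP/ffunP e; apply/eqP/ffunP => i.
    by move: (e i); rewrite !ffunE; case: (g i); case: (h i).
  apply: eq_bigr => h _; rewrite mulr_sumr; apply: eq_bigr => a _.
  by rewrite dot_addg signr_addb; ring.
rewrite (bigD1 [ffun=> false]) //= [X in _ + X]big1 ?addr0.
  rewrite {1}/dot big1 ?expr0 ?mul1r // => i _; by rewrite ffunE.
by move=> a /F0 ->; rewrite mulr0.
Qed.

Definition unit_char (i : 'I_k) : sign_group k := [ffun j => j == i].

Lemma dot_unit i g : dot (unit_char i) g = g i.
Proof.
rewrite /dot (bigD1 i) //= ffunE eqxx /= big1 ?addbF // => j /negPf ji.
by rewrite ffunE ji.
Qed.

Lemma linear_form_unit i : linear_form (unit_char i) = tvar k i.
Proof.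
rewrite /linear_form (bigD1 i) //= ffunE eqxx big1 ?addr0 // => j /negPf ji.
by rewrite ffunE ji.
Qed.

Lemma mcoefM_monomial n (p : tower n) (m e : nat -> nat) :
  (forall i, (i < n)%N -> (m i <= e i)%N) ->
  mcoef (p * \prod_(i < n) tvar n i ^+ m i) e = mcoef p (fun i => e i - m i)%N.
Proof.
elim: n p => [|n IH] p me /=; first by rewrite big_ord0 mulr1.
rewrite big_ord_recr /= eqxx mulrA.
have -> : \prod_(i < n) (if (i : nat) == n then 'X else (tvar n i)%:P) ^+ m i =
    (\prod_(i < n) tvar n i ^+ m i)%:P.
  by rewrite rmorph_prod; apply: eq_bigr => i _; rewrite ltn_eqF // -[RHS]/((tvar n i ^+ m i)%:P) polyC_exp.
rewrite coefMXn ltnNge me //= coefMC IH // => i lt; apply: me.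
exact: ltnW.
Qed.

End Characters.

(** * Continuity of finite sums and products *)

Section ContinuousFunctions.
Local Open Scope classical_set_scope.
Local Open Scope ring_scope.
Variables (R : realType) (T : topologicalType).

Lemma continuous_addr (f g : T -> R) :
  continuous f -> continuous g -> continuous (fun x => f x + g x).
Proof. by move=> cf cg x; apply: cvgD; [exact: cf | exact: cg]. Qed.

Lemma continuous_mulr (f g : T -> R) :
  continuous f -> continuous g -> continuous (fun x => f x * g x).
Proof. by move=> cf cg x; apply: cvgM; [exact: cf | exact: cg]. Qed.

Lemma continuous_mulrl (c : R) (f : T -> R) :
  continuous f -> continuous (fun x => c * f x).
Proof. by apply: continuous_mulr => x; exact: cvg_cst. Qed.

Lemma continuous_sumr (I : Type) (r : seq I) (P : pred I) (f : I -> T -> R) :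
  (forall i, continuous (f i)) -> continuous (fun x => \sum_(i <- r | P i) f i x).
Proof.
by move=> cf; apply: continuous_big => [|i _]; [exact: add_continuous | exact: cf].
Qed.

Lemma continuous_prodr (I : Type) (r : seq I) (P : pred I) (f : I -> T -> R) :
  (forall i, continuous (f i)) -> continuous (fun x => \prod_(i <- r | P i) f i x).
Proof.
by move=> cf; apply: continuous_big => [|i _]; [exact: mul_continuous | exact: cf].
Qed.

Lemma continuous_pos_part (f : T -> R) :
  continuous f -> continuous (fun x => Num.max 0 (f x)).
Proof.
move=> cf x; apply: (@continuous_max _ _ (cst 0)); last exact: cf.
exact: cvg_cst.
Qed.

End ContinuousFunctions.

(** * Families of point sets and orthants *)

Section Orthants.
Local Open Scope classical_set_scope.
Local Open Scope ring_scope.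
Variables (R : realType) (k d : nat).

Definition affine_form (x : 'M[R]_(k, d.+1)) (i : 'I_k) (y : 'rV[R]_d) : R :=
  \sum_(c < d) x i (lift ord0 c) * y 0 c + x i ord0.

Lemma affine_form_flip g x i y :
  affine_form (flip_rows g x) i y = (-1) ^+ g i * affine_form x i y.
Proof.
rewrite /affine_form mulrDr mulr_sumr; congr (_ + _).
  by apply: eq_bigr => c _; rewrite mxE; case: (g i); rewrite ?mulN1r ?mul1r ?mulNr.
by rewrite mxE; case: (g i); rewrite ?mulN1r ?mul1r.
Qed.

Lemma continuous_affine_form i y : continuous (fun x => affine_form x i y).
Proof.
apply: continuous_addr; last exact: coord_continuous.
apply: continuous_sumr => c; under eq_fun do rewrite mulrC.
exact/continuous_mulrl/coord_continuous.
Qed.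

Variables (N m : nat) (S : 'I_N -> seq 'rV[R]_d) (col : 'I_N -> 'I_m).

Definition in_orthant x (g : sign_group k) A :=
  forall i y, y \in S A -> 0 < (-1) ^+ g i * affine_form x i y.

(** A continuous function of x that is positive exactly when the points of S A
    lie in the open orthant g. *)
Definition depth x (g : sign_group k) A : R :=
  \prod_(i < k) \prod_(y <- S A) Num.max 0 ((-1) ^+ g i * affine_form x i y).

Lemma depth_ge0 x g A : 0 <= depth x g A.
Proof. by do 2!apply: prodr_ge0 => ? _; rewrite le_max lexx. Qed.

Lemma depth_neq0 x g A : depth x g A != 0 <-> in_orthant x g A.
Proof.
have E i y : (Num.max 0 ((-1) ^+ g i * affine_form x i y) != 0) =
    (0 < (-1) ^+ g i * affine_form x i y).
  by case: ltP => [/gt_eqF ->|]; rewrite ?eqxx.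
split => [nz i y yS|pos].
  rewrite -E; apply: contraNneq nz => e0; rewrite /depth (bigD1 i) //=.
  by rewrite (big_rem y) //= e0 !mul0r.
apply/prodf_neq0 => i _; rewrite prodf_seq_neq0; apply/allP => y yS /=.
by rewrite E pos.
Qed.

Definition mass (j : 'I_m) (g : sign_group k) x : R := \sum_(A | col A == j) depth x g A.

(** The functions of the second kind, the entries of x, raise the exponents of
    the monomial found by [dickson_expr_monomial] to exactly d. *)
Definition test_index := ('I_m * sign_group k + 'I_k * 'I_d.+1)%type.
Definition test_char (z : test_index) : sign_group k :=
  match z with inl ja => ja.2 | inr ic => unit_char ic.1 end.
Definition test_fun (z : test_index) (x : 'M[R]_(k, d.+1)) : R :=
  match z with
  | inl ja => \sum_g (-1) ^+ dot ja.2 g * mass ja.1 g x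
  | inr ic => x ic.1 ic.2
  end.

Lemma mass_flip j g h x : mass j g (flip_rows h x) = mass j (addg g h) x.
Proof.
apply: eq_bigr => A _; apply: eq_bigr => i _; apply: eq_bigr => y _.
by rewrite affine_form_flip mulrA -signr_addb ffunE.
Qed.

Lemma test_fun_flip z g x :
  test_fun z (flip_rows g x) = (-1) ^+ dot (test_char z) g * test_fun z x.
Proof.
case: z => [[j a]|[i c]] /=; last first.
  by rewrite dot_unit mxE; case: (g i); rewrite ?mulN1r ?mul1r.
rewrite mulr_sumr (reindex_inj (inv_inj (addgK g))) /=; apply: eq_bigr => h _.
by rewrite mass_flip addgK dot_addg signr_addb; ring.
Qed.

Lemma continuous_test_fun z : continuous (test_fun z).
Proof.
case: z => [[j a]|[i c]] /=; last exact: coord_continuous.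
apply: continuous_sumr => g; apply: continuous_mulrl.
apply: continuous_sumr => A; apply: continuous_prodr => i.
apply: continuous_prodr => y; apply: continuous_pos_part.
exact/continuous_mulrl/continuous_affine_form.
Qed.

(** At a common zero of the test functions, the total depth of the colour j is
    the same in all orthants. If it is positive, each orthant contains a set of
    colour j; if it is zero, none does. *)
Theorem equal_orthants p q : (q < 2 ^ p)%N -> m = (2 ^ p + q)%N ->
  d = (2 ^ (k + p - 1) + q)%N ->
  exists2 x : 'M[R]_(k, d.+1), (forall i, exists c, x i c != 0) &
    forall j, (forall g, exists2 A, col A = j & in_orthant x g A) \/
      (forall g A, col A = j -> ~ in_orthant x g A).
Proof.
move=> qp mE dE.
have [e ele en0] := dickson_expr_monomial k qp; rewrite -mE -dE in ele en0.
pose L : seq test_index :=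
  [seq inl ja | ja <- enum [pred ja : 'I_m * sign_group k | ja.2 != [ffun=> false]]] ++
  [seq inr ic | ic <- enum [pred ic : 'I_k * 'I_d.+1 | (ic.2 < d - e ic.1)%N]].
have prodL : \prod_(z <- L) linear_form (test_char z) =
    dickson k ^+ m * \prod_(i < k) tvar k i ^+ (d - e i).
  rewrite big_cat !big_map !big_enum /=; congr (_ * _).
    rewrite -(pair_big_dep xpredT (fun _ a => a != [ffun=> false])
      (fun _ a => linear_form a)) /=.
    by rewrite prodr_const card_ord.
  rewrite -(pair_big_dep xpredT (fun (i : 'I_k) (c : 'I_d.+1) => (c < d - e i)%N)
    (fun i _ => linear_form (unit_char i))) /=.
  apply: eq_bigr => i _; rewrite linear_form_unit prodr_const; congr (_ ^+ _).
  have le : (d - e i <= d.+1)%N by rewrite leqW // leq_subr.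
  rewrite -sum1_card -[RHS](card_ord (d - e i)) -sum1_card.
  by rewrite (big_ord_narrow le) /=.
have coefL : mcoef (\prod_(z <- L) linear_form (test_char z)) (fun=> d) != 0.
  rewrite prodL (@mcoefM_monomial _ _ (fun i => d - e i)%N); last by move=> i _; rewrite leq_subr.
  by rewrite (@eq_mcoef _ _ _ e) // => i /ele ei; rewrite subKn.
have [x x0 fx] := equivariant_common_zero continuous_test_fun test_fun_flip coefL.
exists x => // j.
have const g g' : mass j g x = mass j g' x.
  apply: (constant_of_char_sums (F := fun g => mass j g x)) => a a0.
  apply: (fx (inl (j, a))); rewrite mem_cat; apply/orP; left.
  by apply/mapP; exists (j, a); rewrite ?mem_enum.
have [m0|mn0] := eqVneq (mass j [ffun=> false] x) 0; [right|left].
  move=> g A cA /depth_neq0 /eqP; apply.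
  apply: (@psumr_eq0P _ _ (fun A => col A == j) (fun A => depth x g A)) => //.
  - by move=> B _; exact: depth_ge0.
  - by rewrite -[LHS]/(mass j g x) (const g [ffun=> false]).
  - by rewrite cA.
move=> g; case: (pickP [pred A | (col A == j) && (depth x g A != 0)]).
  by move=> A /andP[/eqP cA /depth_neq0 gA]; exists A.
move=> no; case/eqP: mn0; rewrite (const _ g) /mass big1 // => A cA.
by have := no A; rewrite /= cA /= => /negbFE/eqP.
Qed.

End Orthants.

(** * From orthants to piercing hyperplanes *)

Section Piercing.
Local Open Scope classical_set_scope.
Local Open Scope ring_scope.
Variables (R : realType) (k d : nat).
Implicit Types (x : 'M[R]_(k, d.+1)) (y z : 'rV[R]_d).

Lemma affine_form_conv x i y z (t : R) :
  affine_form x i (t *: y + (1 - t) *: z) =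
  t * affine_form x i y + (1 - t) * affine_form x i z.
Proof.
have -> : t * affine_form x i y + (1 - t) * affine_form x i z =
    \sum_(c < d) (t * (x i (lift ord0 c) * y 0 c) +
                  (1 - t) * (x i (lift ord0 c) * z 0 c)) + x i ord0.
  by rewrite /affine_form big_split /= -!mulr_sumr; ring.
by congr (_ + _); apply: eq_bigr => c _; rewrite !mxE; ring.
Qed.

Lemma convex_set_conv (A : set 'rV[R]_d) y z (t : R) : convex_set A ->
  A y -> A z -> 0 <= t <= 1 -> A (t *: y + (1 - t) *: z).
Proof.
move=> cA Ay Az t01; have t01' : t \in `[0, 1] by rewrite in_itv.
have := cA y z (Itv01 (proj1 (andP t01)) (proj2 (andP t01))).
by rewrite !inE; apply.
Qed.

Lemma convex_hull_convex (A : set 'rV[R]_d) : convex_set (convex_hull A).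
Proof.
move=> y z t; rewrite !inE => Ay Az B [cB AB].
by have := cB y z t; rewrite !inE; apply; [exact: Ay | exact: Az].
Qed.

Lemma affine_form_ivt (A : set 'rV[R]_d) x i y z : convex_set A -> A y -> A z ->
  affine_form x i y <= 0 -> 0 <= affine_form x i z ->
  exists2 w, A w & affine_form x i w = 0.
Proof.
move=> cA Ay Az y0 z0; have [y00|yn0] := eqVneq (affine_form x i y) 0; first by exists y.
have yl : affine_form x i y < 0 by rewrite lt_neqAle yn0.
have s0 : 0 < affine_form x i z - affine_form x i y by lra.
pose t := affine_form x i z / (affine_form x i z - affine_form x i y).
exists (t *: y + (1 - t) *: z); last first.
  by rewrite affine_form_conv /t; field; rewrite gt_eqF.
apply: convex_set_conv => //; rewrite divr_ge0 ?(ltW s0) //=.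
by rewrite ler_pdivrMr // mul1r; lra.
Qed.

Lemma halfspace_hull (s : R) (A : set 'rV[R]_d) x i :
  (forall y, A y -> 0 < s * affine_form x i y) ->
  forall y, convex_hull A y -> 0 < s * affine_form x i y.
Proof.
move=> As; suff sub : convex_hull A `<=` [set y | 0 < s * affine_form x i y].
  by move=> y /sub.
apply: smallest_sub => [y z t|]; last exact: As.
rewrite !inE /= => ys zs.
suff : 0 < s * affine_form x i (t%:num *: y + (1 - t%:num) *: z) by [].
rewrite affine_form_conv.
have t0 : 0 <= t%:num by [].
have t1 : t%:num <= 1 by exact: le1.
have [t00|t00] := eqVneq t%:num 0.
  by rewrite t00 mul0r add0r subr0 mul1r.
have : 0 < t%:num by rewrite lt_neqAle eq_sym t00.
by nra.
Qed.

(** A row whose linear part vanishes is a nonzero constant form, whose zero set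
    is empty, and any hyperplane can take its place. *)
Definition hyperplane_of x (i : 'I_k) : set 'rV[R]_d :=
  if [exists c, x i (lift ord0 c) != 0] then [set y | affine_form x i y = 0]
  else [set y | \sum_(c < d) y 0 c = 0].

Lemma is_hyperplane_of x i : (0 < d)%N -> is_hyperplane (hyperplane_of x i).
Proof.
move=> d0; rewrite /hyperplane_of; case: ifP => [/existsP[c xc]|_].
  exists (\row_c x i (lift ord0 c)), (- x i ord0); split.
    by apply: contraNneq xc => /rowP/(_ c); rewrite !mxE => ->.
  apply/seteqP; split => y /=; rewrite /affine_form.
    move/eqP; rewrite addr_eq0 => /eqP <-; apply: eq_bigr => e _; by rewrite mxE.
  by under eq_bigr do rewrite mxE; move=> ->; rewrite addNr.
exists (const_mx 1), 0; split.
  by apply/eqP => /rowP/(_ (Ordinal d0)); rewrite !mxE => /eqP; rewrite oner_eq0.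
have E y : \sum_(c < d) const_mx 1 0 c * y 0 c = \sum_(c < d) y 0 c :> R.
  by apply: eq_bigr => c _; rewrite mxE mul1r.
by apply/seteqP; split => y /=; rewrite E.
Qed.

Lemma hyperplane_ofP x i y : (exists c, x i c != 0) -> affine_form x i y = 0 ->
  hyperplane_of x i y.
Proof.
move=> [c xc] xy; rewrite /hyperplane_of; case: ifP => // /negbT/existsPn no.
have lin0 e : x i (lift ord0 e) = 0 by have /negPn/eqP := no e.
exfalso; move: xy; rewrite /affine_form big1 => [|e _]; last by rewrite lin0 mul0r.
rewrite add0r => x00; case/negP: xc.
by case: (unliftP ord0 c) => [e ->|->]; rewrite ?lin0 ?x00.
Qed.

(** The point y0 determines the only possible orthant. Some point y violates
    one of its inequalities, and the corresponding form then vanishes somewhere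
    on the segment from y0 to y. *)
Lemma not_in_orthant_pierced x (A : set 'rV[R]_d) : A !=set0 ->
  (forall i, exists c, x i c != 0) ->
  (forall g : sign_group k, ~ forall i y, A y -> 0 < (-1) ^+ g i * affine_form x i y) ->
  exists i, hyperplane_of x i `&` convex_hull A !=set0.
Proof.
move=> [y0 Ay0] x0 noorth.
pose g : sign_group k := [ffun i => affine_form x i y0 < 0].
have /existsNP[i /existsNP[y /not_implyP[Ay /negP]]] := noorth g.
rewrite -leNgt ffunE => gy; exists i.
have sub := @sub_gen_smallest _ (@convex_set R _) A.
suff [w Aw w0] : exists2 w, convex_hull A w & affine_form x i w = 0.
  by exists w; split => //; exact: hyperplane_ofP.
case: ltP gy => [yneg|ypos] gy.
  apply: (affine_form_ivt (@convex_hull_convex A) (sub _ Ay0) (sub _ Ay)).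
    exact: ltW.
  by move: gy; rewrite expr1 mulN1r oppr_le0.
apply: (affine_form_ivt (@convex_hull_convex A) (sub _ Ay) (sub _ Ay0)) => //.
by move: gy; rewrite expr0 mul1r.
Qed.

End Piercing.

Local Open Scope classical_set_scope.

Theorem theorem1p5 (R : realType) (k p q m d : nat)
    (F : set (set 'rV[R]_d)) :
  (1 <= k)%N ->
  (q < 2 ^ p)%N ->
  m = (2 ^ p + q)%N ->
  d = (2 ^ (k + p - 1) + q)%N ->
  finite_set F ->
  (forall P, F P -> is_polytope P) ->
  (chromatic_number (kneser_hypergraph (2 ^ k) F) <= m)%N ->
  exists h : 'I_k -> set 'rV[R]_d,
    (forall i, is_hyperplane (h i)) /\ pierces h F.
Proof.
move=> k_gt0 qp mE dE finF polyF chi_le.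
have d_gt0 : (0 < d)%N by rewrite dE addn_gt0 expn_gt0.
have two_le : (2 <= 2 ^ k)%N by rewrite -[X in (X <= _)%N]expn1 leq_exp2l.
have [c [c_lt c_proper]] : colorable (kneser_hypergraph (2 ^ k) F) m.
  have [n Fn] := kneser_colorable two_le finF (fun A FA => polytope_neq0 (polyF A FA)).
  exact/(chromatic_number_leP m Fn).
have [s Fs] := (finite_seqP F).1 finF.
pose P (A : 'I_(size s)) : set 'rV[R]_d := tnth (in_tuple s) A.
have FP A : F (P A) by rewrite Fs /= mem_tnth.
have exS A : {S : seq 'rV[R]_d | [set` S] !=set0 & P A = convex_hull [set` S]}.
  apply: cid2; have [T [/finite_seqP[t Tt] T0 PT]] := polyF _ (FP A).
  by exists t; rewrite -Tt.
pose S A := s2val (exS A).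
pose col A : 'I_m := Ordinal (c_lt _ (FP A)).
have [x x0 orth] := equal_orthants S col qp mE dE.
exists (hyperplane_of x); split; first by move=> i; exact: is_hyperplane_of.
move=> A; rewrite Fs /= => As.
have [A' ->] : exists A', A = P A'.
  by have /tnthP[A' AA'] : A \in in_tuple s by []; exists A'.
suff [i [y [hy Py]]] : exists i, (hyperplane_of x i `&` P A' !=set0)%classic.
  by exists y; split => //; exists i.
have -> : P A' = convex_hull [set` S A'] := s2valP' (exS A').
apply: not_in_orthant_pierced => //; first exact: s2valP (exS A').
case: (orth (col A')) => [all_orth|none]; last first.
  by move=> g gA; apply: (none g A' erefl) => i y yS; exact: gA.
(* one polytope in each of the 2^k open orthants, all of the same colour: a
   monochromatic hyperedge *)
exfalso.
have card_group : #|{: sign_group k}| = (2 ^ k)%N by rewrite card_ffun card_bool card_ord.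
have choose_orth g : {B | col B = col A' & in_orthant S x g B} := cid2 (all_orth g).
pose B (i : 'I_(2 ^ k)) := s2val (choose_orth (enum_val (cast_ord (esym card_group) i))).
apply: (c_proper (range (P \o B))).
  exists (P \o B); split=> [i||//]; first exact: FP.
  apply/trivIsetP => i j _ _ ij; apply/seteqP; split => // y [].
  pose gi := enum_val (cast_ord (esym card_group) i).
  pose gj := enum_val (cast_ord (esym card_group) j).
  have [e ge] : exists e, gi e != gj e.
    apply/existsP; apply: contraNT ij => /existsPn same.
    have /enum_val_inj/cast_ord_inj -> // : gi = gj.
    by apply/ffunP => e; have /negPn/eqP := same e.
  have side l : (P \o B) l y ->
      (0 < (-1) ^+ (enum_val (cast_ord (esym card_group) l) : sign_group k) e * affine_form x e y)%R.
    rewrite /= (s2valP' (exS (B l))); apply: halfspace_hull => z zS.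
    exact: s2valP' (choose_orth _) e z zS.
  move=> /side + /side; move: ge; rewrite -/gi -/gj.
  by case: (gi e); case: (gj e); rewrite //= expr0 expr1 mul1r mulN1r oppr_gt0;
    move=> _ /lt_trans /[apply]; rewrite ltxx.
exists (c (P A')) => _ [i _ <-] /=.
by have /(congr1 val) := s2valP (choose_orth (enum_val (cast_ord (esym card_group) i))).
Qed.
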